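(* Let $I=(n_1,\dots,n_l)$ be a composition of $n$. Then $\mathcal{A}^{U_I}$ is a free module of rank $2^n$ over the algebra $\mathcal{P}^{U_I}$.
   Context: Let $p$ be a prime, $q=p^r$ with $r\ge 1$, and let $I=(n_1,\dots,n_l)$ be a composition of $n$ (positive integers with $n_1+\cdots+n_l=n$). $V=\mathbb{F}_q^n$ is the natural $\mathrm{GL}_n(q)$-module, $\mathcal{P}=S^\bullet(V)=\mathbb{F}_q[x_1,\dots,x_n]$ is its symmetric algebra, and $\mathcal{A}=S^\bullet(V)\otimes\wedge^\bullet(V)=\mathbb{F}_q[x_1,\dots,x_n]\otimes E[y_1,\dots,y_n]$, where $E[y_1,\dots,y_n]$ is the exterior algebra. A matrix $g=(g_{ij})\in \mathrm{GL}_n(q)$ acts by $\mathbb{F}_q$-algebra automorphisms with $g x_j=\sum_i g_{ij}x_i$ and $g y_j=\sum_i g_{ij}y_i$. $U_I\subseteq \mathrm{GL}_n(q)$ is the group of all block upper triangular matrices, with block sizes $n_1,\dots,n_l$, whose diagonal blocks are the identity matrices $I_{n_1},\dots,I_{n_l}$ and whose blocks above the diagonal are arbitrary. $\mathcal{P}^{G},\mathcal{A}^{G}$ denote the subalgebras of $G$-invariants. *)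

(* Defs.v *)
From HB Require Import structures.
From mathcomp Require Import all_boot all_order all_algebra.
From mathcomp Require Import ring.
From mathcomp Require Import mpoly.

Set Implicit Arguments.
Unset Strict Implicit.
Unset Printing Implicit Defensive.

Import GRing.Theory.
Local Open Scope ring_scope.

Definition free_of_rank (R : nzRingType) (M : lmodType R) (k : nat) : Prop :=
  exists e : 'I_k -> M,
    forall m : M, exists! c : {ffun 'I_k -> R}, m = \sum_(i < k) c i *: e i.

Lemma free_of_rankP (R : nzRingType) (M : lmodType R) (k : nat) :
  free_of_rank M k <-> inhabited (Vector.axiom k M).
Proof.
split=> [[e eP] | [[f f_lin [f' fK f'K]]]].
  have ex (m : M) : exists c : {ffun 'I_k -> R}, m == \sum_(i < k) c i *: e i.
    by have [c [/eqP cP _]] := eP m; exists c.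
  pose co (m : M) : {ffun 'I_k -> R} := xchoose (ex m).
  have coP m : m = \sum_(i < k) co m i *: e i by apply/eqP/(xchooseP (ex m)).
  have coU m (c : {ffun 'I_k -> R}) : m = \sum_(i < k) c i *: e i -> co m = c.
    by have [d [_ dU]] := eP m => /dU <-; symmetry; apply/dU/coP.
  split; exists (fun m => \row_i co m i).
    move=> a u v; apply/rowP=> i; rewrite !mxE.
    rewrite (coU _ [ffun i => a * co u i + co v i]) ?ffunE //.
    rewrite [in LHS](coP u) [in LHS](coP v) scaler_sumr -big_split /=.
    by apply: eq_bigr => j _; rewrite ffunE scalerDl scalerA.
  exists (fun w : 'rV_k => \sum_i w 0 i *: e i) => [m | w].
    by rewrite [RHS]coP; apply: eq_bigr => i _; rewrite mxE.
  apply/rowP=> i; rewrite mxE (coU _ [ffun i => w 0 i]) ?ffunE //.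
  by apply: eq_bigr => j _; rewrite ffunE.
pose fL := GRing.isLinear.Build R M 'rV[R]_k _ f f_lin.
pose fl : {linear M -> 'rV[R]_k} := HB.pack f fL.
have fE (c : 'I_k -> R) :
    f (\sum_i c i *: f' (delta_mx 0 i)) = \row_i c i.
  rewrite -[f _]/(fl _) linear_sum [RHS]row_sum_delta; apply: eq_bigr => i _.
  by rewrite linearZ /= f'K mxE.
exists (fun i => f' (delta_mx 0 i)) => m; exists [ffun i => f m 0 i]; split.
  apply: (can_inj fK); rewrite fE; apply/rowP=> i; by rewrite mxE ffunE.
by move=> c ->; apply/ffunP=> i; rewrite fE ffunE mxE.
Qed.

(* The exterior algebra over R on y_0, ..., y_(n-1): a is identified with      *)
(* \sum_S a S *: y_S, where y_S is the product of the y_j, j in S, taken in    *)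
(* increasing order of j (see ext_basis_prod).                                 *)
Definition extalg (R : Type) (n : nat) := {ffun {set 'I_n} -> R}.

Section ExteriorAlgebra.
Variables (R : comNzRingType) (n : nat).
Implicit Types (S T U V W : {set 'I_n}) (i j : 'I_n).
Local Notation A := (extalg R n).

HB.instance Definition _ := GRing.Lmodule.copy A {ffun {set 'I_n} -> R^o}.

Lemma ext_addE (a b : A) S : (a + b) S = a S + b S.
Proof. exact: ffunE. Qed.

Lemma ext_scaleE (c : R) (a : A) S : (c *: a) S = c * a S.
Proof. exact: ffunE. Qed.

Definition inversions S T : nat := \sum_(i in S) \sum_(j in T) (j < i).

Definition ext_basis S : A := [ffun T => (T == S)%:R].

Definition ext_var j : A := ext_basis [set j].

Definition ext_mul (a b : A) : A :=
  [ffun U => \sum_(S : {set 'I_n})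
               \sum_(T : {set 'I_n} | [disjoint S & T] && (S :|: T == U))
               (-1) ^+ inversions S T * (a S * b T)].

Let kappa S T U : R :=
  if [disjoint S & T] && (S :|: T == U) then (-1) ^+ inversions S T else 0.

Let ext_mulE a b U : ext_mul a b U = \sum_S \sum_T kappa S T U * (a S * b T).
Proof.
rewrite ffunE; apply: eq_bigr => S _; rewrite big_mkcond /=.
by apply: eq_bigr => T _; rewrite /kappa; case: ifP; rewrite ?mul0r.
Qed.

Let sum_setU S T (f : 'I_n -> nat) : [disjoint S & T] ->
  (\sum_(i in S :|: T) f i = \sum_(i in S) f i + \sum_(i in T) f i)%N.
Proof.
by move=> dST; rewrite -bigU //; apply: eq_bigl => i; rewrite !inE.
Qed.

Let inversionsUl S T U : [disjoint S & T] ->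
  inversions (S :|: T) U = (inversions S U + inversions T U)%N.
Proof. by move=> dST; rewrite /inversions sum_setU. Qed.

Let inversionsUr S T U : [disjoint T & U] ->
  inversions S (T :|: U) = (inversions S T + inversions S U)%N.
Proof.
move=> dTU; rewrite /inversions -big_split; apply: eq_bigr => i _ /=.
by rewrite sum_setU.
Qed.

Let kappaA S T V U :
  \sum_W kappa S T W * kappa W V U = \sum_W kappa T V W * kappa S W U.
Proof.
rewrite (bigD1 (S :|: T)) //= [X in _ + X]big1 ?addr0; last first.
  by move=> W ne; rewrite /kappa [_ == W]eq_sym (negPf ne) andbF mul0r.
rewrite (bigD1 (T :|: V)) //= [X in _ = _ + X]big1 ?addr0; last first.
  by move=> W ne; rewrite /kappa [_ == W]eq_sym (negPf ne) andbF mul0r.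
rewrite /kappa !eqxx !andbT setUA.
have ->: [disjoint S :|: T & V] = [disjoint S & V] && [disjoint T & V].
  by rewrite -!setI_eq0 setIUl setU_eq0.
have ->: [disjoint S & T :|: V] = [disjoint S & T] && [disjoint S & V].
  by rewrite -!setI_eq0 setIUr setU_eq0.
case: (boolP [disjoint S & T]) => dST; last by rewrite mul0r /= mulr0.
case: (boolP [disjoint T & V]) => dTV; last by rewrite andbF mul0r mulr0.
case: (boolP [disjoint S & V]) => dSV; last by rewrite /= !mulr0.
rewrite /=; case: ifP => _; last by rewrite !mulr0.
by rewrite -!exprD inversionsUl // inversionsUr //; congr (_ ^+ _); ring.
Qed.

Fact ext_mulA : associative ext_mul.
Proof.
move=> a b c; apply/ffunP=> U; rewrite !ext_mulE.
transitivity (\sum_S \sum_T \sum_V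
   (\sum_W kappa T V W * kappa S W U) * (a S * (b T * c V))).
  apply: eq_bigr => S _.
  under eq_bigr => W _.
    rewrite ext_mulE !mulr_sumr.
    under eq_bigr => T _ do rewrite !mulr_sumr.
    over.
  rewrite exchange_big /=; apply: eq_bigr => T _.
  rewrite exchange_big /=; apply: eq_bigr => V _.
  by rewrite mulr_suml; apply: eq_bigr => W _; ring.
symmetry; transitivity (\sum_V \sum_S \sum_T
   (\sum_W kappa S T W * kappa W V U) * (a S * (b T * c V))); last first.
  rewrite exchange_big /=; apply: eq_bigr => S _.
  rewrite exchange_big /=; apply: eq_bigr => T _.
  by apply: eq_bigr => V _; rewrite kappaA.
rewrite exchange_big /=; apply: eq_bigr => V _.
under eq_bigr => W _.
  rewrite ext_mulE mulr_suml mulr_sumr.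
  under eq_bigr => S _ do rewrite mulr_suml mulr_sumr.
  over.
rewrite exchange_big /=; apply: eq_bigr => S _.
rewrite exchange_big /=; apply: eq_bigr => T _.
by rewrite mulr_suml; apply: eq_bigr => W _; ring.
Qed.

Fact ext_mul1l : left_id (ext_basis set0) ext_mul.
Proof.
move=> a; apply/ffunP=> U; rewrite ext_mulE (bigD1 set0) //= [X in _ + X]big1.
  rewrite (bigD1 U) //= [X in _ + X + _]big1 ?addr0.
    rewrite /kappa -setI_eq0 set0I eqxx set0U eqxx /inversions big_set0.
    by rewrite ffunE eqxx !mul1r.
  by move=> T ne; rewrite /kappa set0U (negPf ne) andbF mul0r.
move=> S ne; rewrite big1 // => T _.
by rewrite [ext_basis _ _]ffunE (negPf ne) mul0r mulr0.
Qed.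

Fact ext_mul1r : right_id (ext_basis set0) ext_mul.
Proof.
move=> a; apply/ffunP=> U; rewrite ext_mulE exchange_big (bigD1 set0) //=.
rewrite [X in _ + X]big1.
  rewrite (bigD1 U) //= [X in _ + X + _]big1 ?addr0.
    rewrite /kappa -setI_eq0 setI0 eqxx setU0 eqxx /inversions big1.
      by rewrite ffunE eqxx mulr1 !mul1r.
    by move=> i _; rewrite big_set0.
  by move=> T ne; rewrite /kappa setU0 (negPf ne) andbF mul0r.
move=> S ne; rewrite big1 // => T _.
by rewrite [ext_basis _ _]ffunE (negPf ne) !mulr0.
Qed.

Fact ext_mulDl : left_distributive ext_mul +%R.
Proof.
move=> a b c; apply/ffunP=> U; rewrite ext_addE !ext_mulE -big_split /=.
apply: eq_bigr => S _; rewrite -big_split /=; apply: eq_bigr => T _.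
by rewrite ext_addE; ring.
Qed.

Fact ext_mulDr : right_distributive ext_mul +%R.
Proof.
move=> a b c; apply/ffunP=> U; rewrite ext_addE !ext_mulE -big_split /=.
apply: eq_bigr => S _; rewrite -big_split /=; apply: eq_bigr => T _.
by rewrite ext_addE; ring.
Qed.

Fact ext_1_neq0 : ext_basis set0 != 0.
Proof.
by apply/eqP=> /ffunP/(_ set0)/eqP; rewrite !ffunE eqxx oner_eq0.
Qed.

HB.instance Definition _ := GRing.Zmodule_isNzRing.Build A
  ext_mulA ext_mul1l ext_mul1r ext_mulDl ext_mulDr ext_1_neq0.

Fact ext_scaleAl (c : R) (a b : A) : c *: (a * b) = (c *: a) * b.
Proof.
apply/ffunP=> U; rewrite ext_scaleE [(a * b) U]ext_mulE [RHS]ext_mulE mulr_sumr.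
apply: eq_bigr => S _; rewrite mulr_sumr; apply: eq_bigr => T _.
by rewrite ext_scaleE; ring.
Qed.

HB.instance Definition _ := GRing.Lmodule_isLalgebra.Build R A ext_scaleAl.

Fact ext_scaleAr (c : R) (a b : A) : c *: (a * b) = a * (c *: b).
Proof.
apply/ffunP=> U; rewrite ext_scaleE [(a * b) U]ext_mulE [RHS]ext_mulE mulr_sumr.
apply: eq_bigr => S _; rewrite mulr_sumr; apply: eq_bigr => T _.
by rewrite ext_scaleE; ring.
Qed.

HB.instance Definition _ := GRing.Lalgebra_isAlgebra.Build R A ext_scaleAr.

Lemma ext_decomp (a : A) : a = \sum_S a S *: ext_basis S.
Proof.
apply/ffunP=> U; rewrite sum_ffunE (bigD1 U) //= big1 ?addr0.
  by rewrite !ffunE eqxx /GRing.scale /= mulr1.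
by move=> S ne; rewrite !ffunE eq_sym (negPf ne) /GRing.scale /= mulr0.
Qed.

Lemma ext_basisM S T :
  ext_basis S * ext_basis T =
    if [disjoint S & T] then (-1) ^+ inversions S T *: ext_basis (S :|: T)
    else 0.
Proof.
apply/ffunP=> U; rewrite [LHS]ext_mulE (bigD1 S) //= [X in _ + X]big1 => [|S' ne].
  rewrite (bigD1 T) //= [X in _ + X + _]big1 ?addr0 => [|T' ne].
    rewrite !ffunE !eqxx !mulr1 /kappa.
    case: ifP => [/andP[-> /eqP->]|].
      by rewrite !ffunE eqxx /GRing.scale /= mulr1.
    case: ifP => _ /=; last by rewrite ffunE.
    by rewrite !ffunE eq_sym /GRing.scale /= => ->; rewrite mulr0.
  by rewrite [X in _ * (_ * X)]ffunE (negPf ne) !mulr0.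
rewrite big1 // => T' _.
by rewrite [X in _ * (X * _)]ffunE (negPf ne) mul0r mulr0.
Qed.

(* Families of pairwise anticommuting elements of square zero *)
Section Anticommuting.
Variables (B : algType R) (z : 'I_n -> B).
Hypothesis zz : forall i, z i * z i = 0.
Hypothesis zC : forall i j, z i * z j = - (z j * z i).

Let Z S : B := \prod_(j in S) z j.

Let ZrE (r : seq 'I_n) i S :
  z i * (\prod_(j <- r | j \in S) z j) =
  (-1) ^+ (count (mem S) r) *: ((\prod_(j <- r | j \in S) z j) * z i).
Proof.
elim: r => [|k r IHr]; first by rewrite !big_nil mulr1 mul1r scale1r.
rewrite !big_cons /=; case: ifP => //= kS.
rewrite [LHS]mulrA zC mulNr -[X in - X]mulrA IHr.
by rewrite -scalerAr exprS -scalerA scaleN1r mulrA.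
Qed.

Let enum_split i : index_enum 'I_n =
  [seq j : 'I_n <- index_enum 'I_n | (j < i)%N] ++
  i :: [seq j : 'I_n <- index_enum 'I_n | (i < j)%N].
Proof.
have eE : index_enum 'I_n = enum 'I_n by rewrite enumT.
rewrite eE; apply: (inj_map val_inj); rewrite map_cat /=.
have fm (p : pred nat) : [seq val j | j : 'I_n <- enum 'I_n & p j]
    = [seq j <- iota 0 n | p j].
  by rewrite -val_enum_ord filter_map.
rewrite (fm (fun j : nat => j < i)%N) (fm (fun j : nat => i < j)%N) val_enum_ord.
have -> : iota 0 n = iota 0 i ++ val i :: iota i.+1 (n - i.+1).
  rewrite -[RHS]/(iota 0 i ++ iota (0 + i) (n - i.+1).+1) -iotaD subnSK //.
  by rewrite subnKC // ltnW.
rewrite !filter_cat /= !ltnn.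
have H1 : all (fun j : nat => j < i)%N (iota 0 i).
  by apply/allP=> j; rewrite mem_iota.
have H2 : all (fun j : nat => i < j)%N (iota i.+1 (n - i.+1)).
  by apply/allP=> j; rewrite mem_iota => /andP[].
have H3 : ~~ has (fun j : nat => i < j)%N (iota 0 i).
  by apply/hasPn=> j; rewrite mem_iota -leqNgt => /ltnW.
have H4 : ~~ has (fun j : nat => j < i)%N (iota i.+1 (n - i.+1)).
  by apply/hasPn=> j; rewrite mem_iota -leqNgt => /andP[/ltnW].
rewrite (all_filterP H1) (all_filterP H2).
move: H3 H4; rewrite !has_filter !negbK => /eqP-> /eqP->.
by rewrite cats0.
Qed.

Let ZsplitE i S : Z S =
  (\prod_(j <- index_enum 'I_n | (j < i)%N && (j \in S)) z j) *
  ((if i \in S then z i else 1) *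
   \prod_(j <- index_enum 'I_n | (i < j)%N && (j \in S)) z j).
Proof.
rewrite /Z {1}(enum_split i).
rewrite big_cat big_cons /= !big_filter_cond.
by case: ifP => //; rewrite mul1r.
Qed.

Let ZvarM i T : z i * Z T =
  if i \in T then 0 else (-1) ^+ inversions [set i] T *: Z (i |: T).
Proof.
rewrite (ZsplitE i T) mulrA -big_filter_cond ZrE -scalerAl -mulrA.
case: ifP => iT; first by rewrite [z i * (_ * _)]mulrA zz mul0r mulr0 scaler0.
rewrite mul1r big_filter_cond; congr (_ *: _).
  rewrite /inversions big_set1 count_filter -sum1_count big_mkcond /=.
  rewrite [in RHS]big_mkcond; congr (_ ^+ _); apply: eq_bigr => j _ /=.
  by case: (j \in T); case: (j < i)%N.
rewrite (ZsplitE i (i |: T)) setU11; congr (_ * (_ * _)).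
  by apply: eq_bigl => j; rewrite !inE; case: eqVneq => [->|//]; rewrite ltnn.
by apply: eq_bigl => j; rewrite !inE; case: eqVneq => [->|//]; rewrite ltnn.
Qed.

Let min_elt S : S != set0 -> {i | i \in S & forall j, j \in S -> (i <= j)%N}.
Proof.
case: (pickP (mem S)) => [i0 iS _ | S0]; last first.
  by case/eqP; apply/setP=> x; rewrite inE; apply: S0.
case: (arg_minnP (fun i : 'I_n => i : nat) iS) => i ? ?.
by exists i.
Qed.

Lemma anticomm_prodM S T :
  (\prod_(j in S) z j) * (\prod_(j in T) z j) =
    if [disjoint S & T] then
      (-1) ^+ inversions S T *: \prod_(j in S :|: T) z j
    else 0.
Proof.
rewrite -!/(Z _); move: {2}#|S| (leqnn #|S|) => m.
elim: m S => [|m IHm] S.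
  rewrite leqn0 cards_eq0 => /eqP->.
  by rewrite /Z big_set0 mul1r -setI_eq0 set0I eqxx set0U /inversions big_set0 scale1r.
case: (eqVneq S set0) => [-> _|]; first by apply: IHm; rewrite cards0.
case/min_elt=> i iS imin; rewrite (cardsD1 i) iS ltnS => Sm.
have iS' : i \notin S :\ i by rewrite !inE eqxx.
have inv0 : inversions [set i] (S :\ i) = 0%N.
  rewrite /inversions big_set1 big1 // => j; rewrite !inE => /andP[_ /imin].
  by rewrite leqNgt => /negPf->.
have defZ : Z S = z i * Z (S :\ i).
  by rewrite ZvarM (negPf iS') inv0 scale1r setD1K.
rewrite defZ -mulrA IHm //.
have -> : [disjoint S & T] = (i \notin T) && [disjoint S :\ i & T].
  by rewrite -{1}(setD1K iS) -!setI_eq0 setIUl setU_eq0 setI_eq0 disjoints1.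
case: ifP => dST; last by rewrite mulr0 andbF.
rewrite andbT -scalerAr ZvarM inE (negPf iS') /=.
case: ifP => iT /=; first by rewrite scaler0.
rewrite scalerA -exprD setUA setD1K // inversionsUr // inv0 add0n.
by rewrite -{3}(setD1K iS) inversionsUl ?disjoints1 // [in RHS]addnC.
Qed.

End Anticommuting.

Lemma ext_var_sqr j : ext_var j * ext_var j = 0.
Proof. by rewrite ext_basisM disjoints1 inE eqxx. Qed.

Lemma ext_varC i j : ext_var i * ext_var j = - (ext_var j * ext_var i).
Proof.
have [->|ne] := eqVneq i j; first by rewrite ext_var_sqr oppr0.
rewrite !ext_basisM !disjoints1 !inE [j == i]eq_sym ne setUC -scaleNr.
congr (_ *: _); rewrite /inversions !big_set1.
by case: (ltngtP i j) ne => [||/val_inj->]; rewrite ?eqxx ?expr1 ?expr0 ?opprK.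
Qed.

Lemma ext_basis_prod S : ext_basis S = \prod_(j in S) ext_var j.
Proof.
pose P m := forall S, #|S| = m -> ext_basis S = \prod_(j in S) ext_var j.
suff: forall m, P m by move/(_ #|S|); apply.
elim=> [T /eqP|m IHm T Tm].
  by rewrite cards_eq0 => /eqP->; rewrite big_set0.
have /card_gt0P[i iT] : (0 < #|T|)%N by rewrite Tm.
have eT : ext_var i * \prod_(j in T :\ i) ext_var j =
          (-1) ^+ inversions [set i] (T :\ i) *: \prod_(j in T) ext_var j.
  have := anticomm_prodM ext_var_sqr ext_varC [set i] (T :\ i).
  by rewrite big_set1 disjoints1 !inE eqxx setD1K.
have: ext_var i * ext_basis (T :\ i) =
      (-1) ^+ inversions [set i] (T :\ i) *: ext_basis T.
  by rewrite ext_basisM disjoints1 !inE eqxx setD1K.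
rewrite (IHm (T :\ i)); last by move: Tm; rewrite (cardsD1 i) iT => -[].
rewrite eT => /(congr1 ( *:%R ((-1) ^+ inversions [set i] (T :\ i)))).
by rewrite !scalerA -!expr2 sqrr_sign !scale1r => ->.
Qed.

Lemma ext_lin_sqr (c : 'I_n -> R) :
  (\sum_i c i *: ext_var i) * (\sum_i c i *: ext_var i) = 0.
Proof.
elim: (index_enum 'I_n) => [|k r IHr]; first by rewrite !big_nil mul0r.
rewrite !big_cons; set w := \sum_(i <- r) _ in IHr *.
have kw : ext_var k * w = - (w * ext_var k).
  rewrite /w mulr_sumr mulr_suml -sumrN; apply: eq_bigr => i _.
  by rewrite -scalerAr -scalerAl ext_varC scalerN.
rewrite mulrDl !mulrDr IHr addr0 -!scalerAl -!scalerAr ext_var_sqr !scaler0.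
by rewrite add0r kw scalerN addNr.
Qed.

Lemma ext_linC (c d : 'I_n -> R) :
  (\sum_i c i *: ext_var i) * (\sum_i d i *: ext_var i) =
  - ((\sum_i d i *: ext_var i) * (\sum_i c i *: ext_var i)).
Proof.
have := ext_lin_sqr (fun i => c i + d i).
under eq_bigr => i _ do rewrite scalerDl.
rewrite big_split /= mulrDl !mulrDr !ext_lin_sqr add0r addr0.
by move/eqP; rewrite addr_eq0 => /eqP.
Qed.

End ExteriorAlgebra.

(* F[x_1, ..., x_n] (x) E[y_1, ..., y_n], seen as the exterior algebra on the *)
(* y_j over the polynomial ring F[x_1, ..., x_n].                             *)
Notation polyext F n := (extalg {mpoly F[n]} n).

Section Action.
Variables (F : finFieldType) (n : nat).
Implicit Types (g : 'M[F]_n) (f : {mpoly F[n]}) (G : {set 'M[F]_n}).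

Local Notation A := (polyext F n).
Implicit Types (a b : A).

Definition mpoly_act g f : {mpoly F[n]} :=
  f \mPo [tuple \sum_(i < n) g i j *: 'X_i | j < n].

HB.instance Definition _ g :=
  GRing.RMorphism.copy (mpoly_act g)
    (comp_mpoly [tuple \sum_(i < n) g i j *: 'X_i | j < n]).

Definition var_act g (j : 'I_n) : A :=
  \sum_(i < n) (g i j)%:MP *: ext_var {mpoly F[n]} i.

Definition polyext_act g a : A :=
  \sum_(S : {set 'I_n}) mpoly_act g (a S) *: \prod_(j in S) var_act g j.

Lemma mpoly_actX g j : mpoly_act g 'X_j = \sum_(i < n) g i j *: 'X_i.
Proof. by rewrite /mpoly_act comp_mpolyXU -tnth_nth tnth_mktuple. Qed.

Lemma mpoly_actC g (c : F) : mpoly_act g c%:MP = c%:MP.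
Proof. exact: comp_mpolyC. Qed.

Lemma polyext_act_basis g S :
  polyext_act g (ext_basis {mpoly F[n]} S) = \prod_(j in S) var_act g j.
Proof.
rewrite /polyext_act (bigD1 S) //= [X in _ + X]big1 ?addr0 => [|T ne].
  by rewrite ffunE eqxx rmorph1 scale1r.
by rewrite ffunE (negPf ne) rmorph0 scale0r.
Qed.

Lemma polyext_act_var g j :
  polyext_act g (ext_var {mpoly F[n]} j) = var_act g j.
Proof. by rewrite polyext_act_basis big_set1. Qed.

Lemma polyext_actZ g f a :
  polyext_act g (f *: a) = mpoly_act g f *: polyext_act g a.
Proof.
rewrite /polyext_act scaler_sumr; apply: eq_bigr => S _.
by rewrite ffunE /= rmorphM scalerA.
Qed.

Fact polyext_act_is_zmod_morphism g : zmod_morphism (polyext_act g).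
Proof.
move=> a b; rewrite /polyext_act -sumrB; apply: eq_bigr => S _.
by rewrite !ffunE rmorphB scalerBl.
Qed.
HB.instance Definition _ g :=
  GRing.isZmodMorphism.Build A A (polyext_act g)
    (polyext_act_is_zmod_morphism g).

Fact polyext_act_is_monoid_morphism g : monoid_morphism (polyext_act g).
Proof.
split=> [|a b]; first by rewrite polyext_act_basis big_set0.
have actE (c : A) : polyext_act g c =
    \sum_S mpoly_act g (c S) *: polyext_act g (ext_basis _ S).
  by apply: eq_bigr => S _; rewrite polyext_act_basis.
have basisM S T : polyext_act g (ext_basis _ S * ext_basis _ T) =
    polyext_act g (ext_basis _ S) * polyext_act g (ext_basis _ T).
  rewrite !polyext_act_basis anticomm_prodM; last first.
  - by move=> i j; apply: ext_linC.
  - by move=> i; apply: ext_lin_sqr.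
  rewrite ext_basisM; case: ifP => _; last exact: raddf0.
  by rewrite polyext_actZ polyext_act_basis rmorph_sign.
have -> : a * b = \sum_S \sum_T
    (a S * b T) *: (ext_basis {mpoly F[n]} S * ext_basis {mpoly F[n]} T).
  rewrite [in LHS](ext_decomp a) [in LHS](ext_decomp b) mulr_suml.
  apply: eq_bigr => S _; rewrite mulr_sumr; apply: eq_bigr => T _.
  by rewrite -scalerAl -scalerAr scalerA.
rewrite (actE a) (actE b) mulr_suml raddf_sum; apply: eq_bigr => S _.
rewrite mulr_sumr raddf_sum; apply: eq_bigr => T _.
by rewrite -scalerAl -scalerAr scalerA /= polyext_actZ basisM rmorphM.
Qed.
HB.instance Definition _ g :=
  GRing.isMonoidMorphism.Build A A (polyext_act g)
    (polyext_act_is_monoid_morphism g).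

Definition mpoly_inv G : {pred {mpoly F[n]}} :=
  [pred f | [forall g in G, mpoly_act g f == f]].

Definition polyext_inv G : {pred A} :=
  [pred a | [forall g in G, polyext_act g a == a]].

Fact mpoly_inv_subring G : subring_closed (mpoly_inv G).
Proof.
split=> [|f h /forall_inP fG /forall_inP hG|f h /forall_inP fG /forall_inP hG];
  apply/forall_inP => g gG.
- by rewrite rmorph1.
- by rewrite rmorphB /= (eqP (fG g gG)) (eqP (hG g gG)).
by rewrite rmorphM /= (eqP (fG g gG)) (eqP (hG g gG)).
Qed.
HB.instance Definition _ G :=
  GRing.isSubringClosed.Build {mpoly F[n]} (mpoly_inv G) (mpoly_inv_subring G).

Fact polyext_inv_subring G : subring_closed (polyext_inv G).
Proof.
split=> [|f h /forall_inP fG /forall_inP hG|f h /forall_inP fG /forall_inP hG];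
  apply/forall_inP => g gG.
- by rewrite rmorph1.
- by rewrite rmorphB /= (eqP (fG g gG)) (eqP (hG g gG)).
by rewrite rmorphM /= (eqP (fG g gG)) (eqP (hG g gG)).
Qed.
HB.instance Definition _ G :=
  GRing.isSubringClosed.Build A (polyext_inv G) (polyext_inv_subring G).

Record mpoly_invariants G := MpolyInvariant
  { mpoly_inv_val :> {mpoly F[n]}; _ : mpoly_inv_val \in mpoly_inv G }.
HB.instance Definition _ G := [isSub for @mpoly_inv_val G].
HB.instance Definition _ G := [Choice of mpoly_invariants G by <:].
HB.instance Definition _ G :=
  [SubChoice_isSubComNzRing of mpoly_invariants G by <:].

Record polyext_invariants G := PolyextInvariant
  { polyext_inv_val :> A; _ : polyext_inv_val \in polyext_inv G }.
HB.instance Definition _ G := [isSub for @polyext_inv_val G].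
HB.instance Definition _ G := [Choice of polyext_invariants G by <:].
HB.instance Definition _ G :=
  [SubChoice_isSubNzRing of polyext_invariants G by <:].

Fact polyext_inv_scale_subproof G (f : mpoly_invariants G)
  (a : polyext_invariants G) : (val f *: val a : A) \in polyext_inv G.
Proof.
apply/forall_inP=> g gG; rewrite polyext_actZ.
by rewrite (eqP (forall_inP (valP f) g gG)) (eqP (forall_inP (valP a) g gG)).
Qed.

Definition polyext_inv_scale G (f : mpoly_invariants G)
    (a : polyext_invariants G) : polyext_invariants G :=
  PolyextInvariant (polyext_inv_scale_subproof f a).

Fact polyext_inv_scaleA G (f h : mpoly_invariants G)
    (a : polyext_invariants G) :
  polyext_inv_scale f (polyext_inv_scale h a) = polyext_inv_scale (f * h) a.
Proof. by apply: val_inj; rewrite /= scalerA. Qed.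
Fact polyext_inv_scale1 G : left_id 1 (@polyext_inv_scale G).
Proof. by move=> a; apply: val_inj; rewrite /= scale1r. Qed.
Fact polyext_inv_scaleDr G : right_distributive (@polyext_inv_scale G) +%R.
Proof. by move=> f a b; apply: val_inj; rewrite /= scalerDr. Qed.
Fact polyext_inv_scaleDl G (a : polyext_invariants G) :
  {morph (@polyext_inv_scale G)^~ a : f h / f + h}.
Proof. by move=> f h; apply: val_inj; rewrite /= scalerDl. Qed.
HB.instance Definition _ G :=
  GRing.Zmodule_isLmodule.Build (mpoly_invariants G) (polyext_invariants G)
    (@polyext_inv_scaleA G) (@polyext_inv_scale1 G) (@polyext_inv_scaleDr G)
    (@polyext_inv_scaleDl G).

(* reshape_index I i is the index of the block of I containing position i; *)
(* when block j <= block i, the entry (i, j) lies in or below a diagonal   *)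
(* block, where g agrees with the identity matrix.                         *)
Definition block_unipotent (I : seq nat) : {set 'M[F]_n} :=
  [set g : 'M[F]_n | (g \in unitmx) &&
    [forall i : 'I_n, forall j : 'I_n,
      (reshape_index I j <= reshape_index I i)%N ==>
        (g i j == (i == j)%:R)]].

End Action.

(* Main.v *)
(* Write N_s for the additive polynomial over F_q whose roots are the linear  *)
(* forms in x_0, ..., x_(s-1). Over the fraction field K of the polynomial    *)
(* ring P, the triangular system y_k = \sum_(s <= k) N_s(x_k) theta_s defines  *)
(* one-forms theta_s that are invariant under all upper unitriangular         *)
(* matrices. If the block of j starts at m, then                              *)
(*   zeta_j = y_j - \sum_(s < m) N_s(x_j) theta_s                              *)
(* is invariant under U_I, and with zeta_s = theta_s for s < m and            *)
(* L_m = \prod_(s < m) N_s(x_s) the forms                                     *)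
(*   L_m zeta_j \prod_(i in T) zeta_i      (T contained in {0, ..., j - 1})    *)
(* together with 1 are the 2^n members of a basis.                            *)
(* Let a be an invariant form in y_0, ..., y_j and b the coefficient of y_j.  *)
(* Invariance under x_j -> x_j + w, with w ranging over the q^m linear forms  *)
(* in x_0, ..., x_(m-1), forces a - zeta_j b and the theta_s b, s < m, to have *)
(* polynomial coefficients, as the N_s(x_j) have distinct degrees below q^m   *)
(* in x_j. Contraction then shows that zeta_T b is polynomial for every T,    *)
(* and the pairing of the exterior algebra into top degree turns this into    *)
(* b being a P-combination of the L_m zeta_T. One concludes by induction on j. *)

Require Import Defs.
From mathcomp Require Import all_boot all_order all_algebra.
From HB Require Import structures.
From mathcomp Require Import all_field.
From mathcomp Require Import ring zify.
From mathcomp Require Import mpoly.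

Set Implicit Arguments.
Unset Strict Implicit.
Unset Printing Implicit Defensive.

Import GRing.Theory.
Local Open Scope ring_scope.

(** * Contractions of exterior forms *)

(** Two properties of U_I carry the proof. Every element adds to x_j and to y_j combinations, with
    the same coefficients, of the variables before the block of j ([adapted]), and every such change
    of a single index occurs ([transvection]). The first property makes the zeta_j invariant: the
    N_s are additive, so adding a linear form w to x_j changes \sum_s N_s(x_j) theta_s by exactly
    the form added to y_j ([flag_residue_form], [flag_residue_adapted]). What remains is to decide
    which denominators can occur.

    The second property settles this. If d_0 + \sum_(s < m) N_s(x_j) d_s = L h, where L is free of
    x_j and the d's are invariant under the shifts of x_j, then L divides each d: modulo N_m, of
    degree q^m in x_j, an invariant polynomial is constant in x_j, while 1 and the N_s are monic of
    distinct degrees below q^m ([shift_invariant_dvd], [transvection_invariant_dvd]). For an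
    invariant form with last variable y_j and coefficient b of y_j, this shows that all zeta_s b are
    polynomial. By [frame_decomposition], b is then L_m times a polynomial combination of the
    zeta_T, which gives [transvection_fixed_peel].

    Peeling off one y_j after another expands every invariant form in the basis ([flag_basis_span]).
    Contraction with the highest variable proves independence over the whole polynomial ring
    ([flag_basis_independent]), and uniqueness of the expansion forces its coefficients to be
    invariant ([adapted_invariants_free]). The basis is indexed by the subsets of the n indices: a
    nonempty one is T together with its maximum j. *)

Section Contraction.
Variables (R : comNzRingType) (n : nat).
Implicit Types (S T U : {set 'I_n}) (i k : 'I_n) (j : nat) (a b : extalg R n).
Local Notation A := (extalg R n).
Local Notation y := (ext_var R).

Lemma ext_oppE a S : (- a) S = - a S.
Proof. exact: ffunE. Qed.

Lemma ext_varM_coef k b U :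
  (y k * b) U =
    if k \in U then (-1) ^+ inversions [set k] (U :\ k) * b (U :\ k) else 0.
Proof.
rewrite -[y k * b]/(ext_mul _ _) ffunE (bigD1 [set k]) //=.
rewrite [X in _ + X]big1 ?addr0; last first.
  by move=> S ne; apply: big1 => T _; rewrite ffunE (negPf ne) mul0r mulr0.
case: ifP => kU.
  rewrite (big_pred1 (U :\ k)) ?ffunE ?eqxx ?mul1r // => T /=.
  rewrite disjoints1; apply/andP/eqP => [[kT /eqP <-]|->].
    by rewrite setU1K.
  by rewrite setD1K // !inE eqxx.
by rewrite big_pred0 // => T; apply/andP=> -[_ /eqP eU]; rewrite -eU setU11 in kU.
Qed.

Lemma inversions1U i S T : [disjoint S & T] ->
  inversions [set i] (S :|: T) = (inversions [set i] S + inversions [set i] T)%N.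
Proof.
move=> dST; rewrite /inversions !big_set1 -bigU //=.
by apply: eq_bigl => j; rewrite !inE.
Qed.

Lemma inversions11 (i j : 'I_n) : inversions [set i] [set j] = (j < i)%N.
Proof. by rewrite /inversions !big_set1. Qed.

(** Interior product with the dual vector of y_i, that is, the coefficient of y_i once y_i is moved
    to the front; the sign counts the elements of [S] below [i]. *)
Definition ext_contract i a : A :=
  [ffun S : {set _} => if i \in S then 0 else (-1) ^+ inversions [set i] S * a (i |: S)].

Fact ext_contract_is_linear i : linear (ext_contract i).
Proof.
move=> c a b; apply/ffunP=> S.
rewrite ext_addE ext_scaleE !ffunE; case: ifP => _; first by rewrite mulr0 addr0.
by rewrite -[_ *: _]/(c * _); ring.
Qed.
HB.instance Definition _ i :=
  GRing.isLinear.Build R A A _ (ext_contract i) (ext_contract_is_linear i).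

Lemma ext_contractD i a b :
  ext_contract i (a + b) = ext_contract i a + ext_contract i b.
Proof. exact: raddfD. Qed.

Lemma ext_contractZ i c a : ext_contract i (c *: a) = c *: ext_contract i a.
Proof. exact: linearZ. Qed.

Lemma ext_contract_varM i k b :
  ext_contract i (y k * b) = (i == k)%:R *: b - y k * ext_contract i b.
Proof.
apply/ffunP=> S; rewrite ext_addE ext_scaleE ext_oppE.
rewrite [LHS]ffunE !ext_varM_coef !ffunE !inE.
have [<-|ne] := eqVneq i k; rewrite ?eqxx ?mul1r ?mul0r /=.
  have [iS|iS] := boolP (i \in S); last by rewrite setU1K // mulrA -expr2 sqrr_sign; ring.
  by rewrite setD1K // mulrA -expr2 sqrr_sign; ring.
rewrite ?(negPf ne) ?[k == i]eq_sym ?(negPf ne) /=.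
have [iS|iS] := boolP (i \in S); first by case: ifP; rewrite ?mulr0 oppr0 addr0.
have [kS|kS] := boolP (k \in S); last by rewrite mulr0 oppr0 addr0.
have eS : (i |: S) :\ k = i |: (S :\ k).
  apply/setP=> l; rewrite !inE; case: eqVneq => [->|]; rewrite ?andbT ?andbF //=.
  by rewrite eq_sym (negPf ne).
rewrite sub0r eS !mulrA -!exprD -mulNr; congr (_ * _).
rewrite -{1}(setD1K kS) !inversions1U ?inversions11 ?disjoints1 ?inE ?eqxx;
  rewrite ?(negPf iS) ?andbF //.
rewrite -[in RHS]mulN1r -[in RHS]exprS.
have : ((k < i) + (i < k))%N = 1%N by move/eqP: ne; case: (ltngtP k i) => // /val_inj ->.
by move=> e1; rewrite addnACA e1 add1n addnC.
Qed.

Lemma ext_contract1 i : ext_contract i 1 = 0.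
Proof.
apply/ffunP=> S; rewrite !ffunE; case: ifP => // _.
have -> : (i |: S == set0) = false by apply/eqP=> /setP/(_ i); rewrite !inE eqxx.
by rewrite mulr0.
Qed.

Lemma ext_split (j : 'I_n) a S :
  (a - y j * ext_contract j a) S = if j \in S then 0 else a S.
Proof.
rewrite ext_addE ext_oppE ext_varM_coef; case: ifP => jS; last by rewrite subr0.
by rewrite ffunE !inE eqxx setD1K // mulrA -expr2 sqrr_sign mul1r subrr.
Qed.

Lemma ext_ind (Q : A -> Prop) :
  (forall c a b, Q a -> Q b -> Q (c *: a + b)) -> Q 0 -> Q 1 ->
  (forall k b, Q b -> Q (y k * b)) -> forall a, Q a.
Proof.
move=> Qlin Q0 Q1 Qvar a; rewrite [a]ext_decomp.
elim: (index_enum _) => [|S r IHr]; first by rewrite big_nil.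
rewrite big_cons; apply: Qlin => //; rewrite ext_basis_prod.
elim: (index_enum _) => [|i s IHs]; first by rewrite big_nil.
by rewrite big_cons; case: ifP => // _; apply: Qvar.
Qed.

Lemma ext_contract_var i k : ext_contract i (y k) = (i == k)%:R *: 1.
Proof.
by rewrite -[y k]mulr1 ext_contract_varM ext_contract1 mulr0 subr0.
Qed.

Lemma ext_contract_linM i (c : 'I_n -> R) b :
  ext_contract i ((\sum_k c k *: y k) * b) =
    ext_contract i (\sum_k c k *: y k) * b -
    (\sum_k c k *: y k) * ext_contract i b.
Proof.
rewrite mulr_suml [ext_contract i (\sum_k _)]linear_sum.
rewrite [ext_contract i (\sum_k _)]linear_sum !mulr_suml -sumrB.
apply: eq_bigr => k _ /=.
rewrite -!scalerAl !linearZ /= ext_contract_varM ext_contract_var.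
by rewrite scalerBr -!scalerAl mul1r scalerN.
Qed.

(** Stated for semilinear [phi] because the group action also moves the coefficients. The condition
    on [c k i] says that y_i occurs in [phi (y k)] only for k = i, with coefficient 1. *)
Lemma ext_contract_morph (f : R -> R) (phi : A -> A) i (c : 'I_n -> 'I_n -> R) :
  (forall a b, phi (a + b) = phi a + phi b) ->
  (forall (r : R) a, phi (r *: a) = f r *: phi a) ->
  (forall a b, phi (a * b) = phi a * phi b) ->
  phi 0 = 0 -> phi 1 = 1 ->
  (forall k, phi (y k) = \sum_l c k l *: y l) ->
  (forall k, c k i = (i == k)%:R) ->
  forall a, ext_contract i (phi a) = phi (ext_contract i a).
Proof.
move=> phiD phiZ phiM phi0 phi1 phi_var ci; apply: ext_ind => [b a a' ea ea'||| k b eb].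
- by rewrite phiD phiZ !ext_contractD !ext_contractZ ea ea' phiD phiZ.
- by rewrite phi0 linear0 phi0.
- by rewrite phi1 ext_contract1 phi0.
have phiN a : phi (- a) = - phi a.
  by apply/eqP; rewrite -addr_eq0 -phiD addNr phi0.
have ei : ext_contract i (phi (y k)) = (i == k)%:R *: 1.
  rewrite phi_var linear_sum (bigD1 i) //= big1 => [|l ne].
    by rewrite ext_contractZ ext_contract_var eqxx scale1r addr0 ci.
  by rewrite ext_contractZ ext_contract_var eq_sym (negPf ne) scale0r scaler0.
rewrite phiM {1}phi_var ext_contract_linM -phi_var ei eb ext_contract_varM.
rewrite phiD phiN phiM -scalerAl mul1r; congr (_ - _).
by case: eqP => _; rewrite ?scale0r ?scale1r // phi0.
Qed.

Definition ext_homog (d : nat) a := forall S, #|S| != d -> a S = 0.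

Lemma ext_homog_linM d (c : 'I_n -> R) b :
  ext_homog d b -> ext_homog d.+1 ((\sum_k c k *: y k) * b).
Proof.
move=> hb S hS; rewrite mulr_suml sum_ffunE big1 // => k _.
rewrite -scalerAl ext_scaleE ext_varM_coef; case: ifP => [kS|_]; rewrite ?mulr0 //.
by rewrite hb ?mulr0 //; apply: contra hS => /eqP <-; rewrite (cardsD1 k S) kS.
Qed.

(** The pairing of complementary degrees: any coefficient of [a] can be read off, up to sign, in top
    degree. *)
Lemma ext_basisM_top S a :
  (ext_basis R (~: S) * a) setT = (-1) ^+ inversions (~: S) S * a S.
Proof.
rewrite -[ext_basis _ _ * a]/(ext_mul _ _) ffunE (bigD1 (~: S)) //=.
rewrite [X in _ + X]big1 ?addr0; last first.
  by move=> T ne; apply: big1 => U _; rewrite ffunE (negPf ne) mul0r mulr0.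
rewrite (big_pred1 S) ?ffunE ?eqxx ?mul1r // => T /=.
rewrite -setI_eq0; apply/andP/eqP => [[/eqP d /eqP e]|->]; last first.
  by rewrite setIC setICr setUC setUCr !eqxx.
apply/setP=> i; move/setP/(_ i): d; move/setP/(_ i): e; rewrite !inE.
by case: (i \in S); case: (i \in T).
Qed.

Definition ext_below (j : nat) a :=
  forall S, ~~ (S \subset [set i : 'I_n | (i < j)%N]) -> a S = 0.

Lemma ext_belowD j a b : ext_below j a -> ext_below j b -> ext_below j (a + b).
Proof. by move=> ha hb S hS; rewrite ext_addE ha ?hb ?addr0. Qed.

Lemma ext_belowZ j c a : ext_below j a -> ext_below j (c *: a).
Proof. by move=> ha S hS; rewrite ext_scaleE ha ?mulr0. Qed.

Lemma ext_below_sum (J : Type) (r : seq J) (Q : pred J) j (a : J -> A) :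
  (forall l, Q l -> ext_below j (a l)) -> ext_below j (\sum_(l <- r | Q l) a l).
Proof.
move=> ha; elim/big_rec: _ => [S _|l b Ql hb]; first by rewrite ffunE.
exact/ext_belowD/hb/ha.
Qed.

Lemma ext_below_varM j k b : (k < j)%N -> ext_below j b -> ext_below j (y k * b).
Proof.
move=> kj hb S hS; rewrite ext_varM_coef; case: ifP => // kS.
rewrite hb ?mulr0 //; apply: contra hS => hS.
by rewrite -(setD1K kS) subUset sub1set inE kj.
Qed.

Lemma ext_belowW j (k : nat) a : (j <= k)%N -> ext_below j a -> ext_below k a.
Proof.
move=> jk ha S hS; apply/ha; apply: contra hS => /subset_trans; apply.
by apply/subsetP=> i; rewrite !inE => /leq_trans; apply.
Qed.

Lemma ext_below_contract (j : 'I_n) a :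
  ext_below j.+1 a -> ext_below j (ext_contract j a).
Proof.
move=> ha S hS; rewrite ffunE; case: ifPn => // jS; rewrite ha ?mulr0 //.
apply: contra hS; rewrite subUset => /andP[_ /subsetP hS].
apply/subsetP=> i iS; have := hS i iS; rewrite !inE ltnS leq_eqVlt.
by case/orP=> // /eqP/val_inj ij; rewrite -ij iS in jS.
Qed.

Lemma ext_below_split (j : 'I_n) a :
  ext_below j.+1 a -> ext_below j (a - y j * ext_contract j a).
Proof.
move=> ha S hS; rewrite ext_split; case: ifPn => // jS; apply: ha.
apply: contra hS => /subsetP hS.
apply/subsetP=> i iS; have := hS i iS; rewrite !inE ltnS leq_eqVlt.
by case/orP=> // /eqP/val_inj ij; rewrite -ij iS in jS.
Qed.

Lemma ext_below_eq0 a : ext_below 0 a -> a = a set0 *: 1.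
Proof.
move=> ha; apply/ffunP=> S; rewrite ext_scaleE ffunE.
have [->|nS] := eqVneq S set0; first by rewrite mulr1.
rewrite mulr0 ha //; apply: contra nS => /subsetP hS; apply/eqP/setP=> i.
by rewrite inE; apply/negP=> /hS; rewrite inE.
Qed.

Lemma ext_below_ind j a (Q : A -> Prop) :
  (forall b c, Q b -> Q c -> Q (b + c)) -> Q 0 ->
  (forall S b, Q b -> Q (a S *: b)) -> Q 1 ->
  (forall k b, (k < j)%N -> Q b -> Q (y k * b)) -> ext_below j a -> Q a.
Proof.
move=> QD Q0 QZ Q1 Qvar ha; rewrite [a]ext_decomp.
elim: (index_enum _) => [|S r IHr]; first by rewrite big_nil.
rewrite big_cons; apply: QD => //.
have [hS|hS] := boolP (S \subset [set i : 'I_n | (i < j)%N]); last first.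
  by rewrite ha // scale0r.
apply: QZ; rewrite ext_basis_prod; move/subsetP: hS => hS.
elim: (index_enum _) => [|i s IHs]; first by rewrite big_nil.
rewrite big_cons; case: ifP => // /hS; rewrite inE => ij.
exact: Qvar.
Qed.

Lemma ext_below_all a : ext_below n a.
Proof. by move=> S /negP[]; apply/subsetP=> i; rewrite inE. Qed.

Lemma ext_contract_below j i a : (j <= i)%N -> ext_below j a ->
  ext_contract i a = 0.
Proof.
move=> ji ha; apply/ffunP=> S; rewrite !ffunE; case: ifP => // _.
rewrite ha ?mulr0 //; apply/negP=> /subsetP/(_ i).
by rewrite !inE eqxx => /(_ isT); rewrite ltnNge ji.
Qed.

End Contraction.

Lemma scalerM_sum (R : comNzRingType) (B : algType R) (J : finType) (u v : R)
    (z : B) (c : J -> R) (w : J -> B) :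
  (u *: z) * (v *: \sum_l c l *: w l) = u *: (v *: \sum_l c l *: (z * w l)).
Proof.
rewrite -scalerAl -scalerAr mulr_sumr; congr (_ *: (_ *: _)).
by apply: eq_bigr => l _; rewrite scalerAr.
Qed.

Lemma ext_scale_prod (R : comNzRingType) (n : nat) (T : {set 'I_n}) (u : R)
    (z : extalg R n) (w : 'I_n -> extalg R n) :
  u ^+ #|T|.+1 *: (u *: (z * \prod_(i in T) w i)) =
  u *: ((u *: z) * \prod_(i in T) (u *: w i)).
Proof. by rewrite scaler_prodl -scalerAl -scalerAr !scalerA exprS mulrAC. Qed.

(** * Extension of scalars, in particular to the fraction field *)

Section BaseChange.
Variables (R R' : comNzRingType) (f : {rmorphism R -> R'}) (n : nat).

Definition map_ext (a : extalg R n) : extalg R' n := [ffun S : {set _} => f (a S)].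

Lemma map_extE a S : map_ext a S = f (a S).
Proof. exact: ffunE. Qed.

Fact map_ext_is_zmod_morphism : zmod_morphism map_ext.
Proof. by move=> a b; apply/ffunP=> S; rewrite !ffunE rmorphB. Qed.
HB.instance Definition _ := GRing.isZmodMorphism.Build
  (extalg R n) (extalg R' n) map_ext map_ext_is_zmod_morphism.

Fact map_ext_is_monoid_morphism : monoid_morphism map_ext.
Proof.
split=> [|a b]; apply/ffunP=> S.
  by rewrite !ffunE; case: eqP => _; rewrite ?rmorph1 ?rmorph0.
rewrite map_extE -[a * b]/(ext_mul _ _) -[RHS]/(ext_mul _ _ _) !ffunE rmorph_sum.
apply: eq_bigr => T _; rewrite rmorph_sum; apply: eq_bigr => U _.
by rewrite !rmorphM rmorph_sign !map_extE.
Qed.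
HB.instance Definition _ := GRing.isMonoidMorphism.Build
  (extalg R n) (extalg R' n) map_ext map_ext_is_monoid_morphism.

Lemma map_extZ c a : map_ext (c *: a) = f c *: map_ext a.
Proof. by apply/ffunP=> S; rewrite !(map_extE, ext_scaleE) rmorphM. Qed.

Lemma map_ext_basis S : map_ext (ext_basis R S) = ext_basis R' S.
Proof.
by apply/ffunP=> T; rewrite !ffunE; case: eqP => _; rewrite ?rmorph1 ?rmorph0.
Qed.

Lemma map_ext_var i : map_ext (ext_var R i) = ext_var R' i.
Proof. exact: map_ext_basis. Qed.

Lemma map_ext_inj : injective f -> injective map_ext.
Proof. by move=> fI a b /ffunP e; apply/ffunP=> S; apply: fI; rewrite -!map_extE. Qed.

Lemma map_ext_contract i a :
  map_ext (ext_contract i a) = ext_contract i (map_ext a).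
Proof.
apply/ffunP=> S; rewrite !ffunE; case: ifP => _; first exact: rmorph0.
by rewrite rmorphM rmorph_sign.
Qed.

Lemma map_ext_below j a : ext_below j a -> ext_below j (map_ext a).
Proof. by move=> ha S hS; rewrite ffunE ha ?rmorph0. Qed.

End BaseChange.

Section FractionExtension.
Variables (P : idomainType) (n : nat).
Implicit Types a b : extalg P n.

Definition frac_ext a : extalg {fraction P} n := map_ext (@tofrac P) a.

Lemma frac_extE a S : frac_ext a S = tofrac (a S).
Proof. exact: map_extE. Qed.

Lemma frac_extD a b : frac_ext (a + b) = frac_ext a + frac_ext b.
Proof. exact: rmorphD. Qed.

Lemma frac_extM a b : frac_ext (a * b) = frac_ext a * frac_ext b.
Proof. exact: rmorphM. Qed.

Lemma frac_ext0 : frac_ext 0 = 0.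
Proof. exact: rmorph0. Qed.

Lemma frac_ext1 : frac_ext 1 = 1.
Proof. exact: rmorph1. Qed.

Lemma frac_ext_sum (J : Type) (r : seq J) (Q : pred J) (a : J -> extalg P n) :
  frac_ext (\sum_(l <- r | Q l) a l) = \sum_(l <- r | Q l) frac_ext (a l).
Proof. exact: rmorph_sum. Qed.

Lemma frac_ext_prod (J : Type) (r : seq J) (Q : pred J) (a : J -> extalg P n) :
  frac_ext (\prod_(l <- r | Q l) a l) = \prod_(l <- r | Q l) frac_ext (a l).
Proof. exact: rmorph_prod. Qed.

Lemma frac_extZ c a : frac_ext (c *: a) = tofrac c *: frac_ext a.
Proof. exact: map_extZ. Qed.

Lemma frac_ext_var i : frac_ext (ext_var P i) = ext_var {fraction P} i.
Proof. exact: map_ext_var. Qed.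

Lemma frac_ext_contract i a :
  frac_ext (ext_contract i a) = ext_contract i (frac_ext a).
Proof. exact: map_ext_contract. Qed.

Lemma frac_ext_below j a : ext_below j a -> ext_below j (frac_ext a).
Proof. exact: map_ext_below. Qed.

Lemma tofrac_inj : injective (@tofrac P).
Proof. by move=> p q /eqP; rewrite tofrac_eq => /eqP. Qed.

Lemma frac_ext_inj : injective frac_ext.
Proof. exact: map_ext_inj tofrac_inj. Qed.

End FractionExtension.

(** * Frames of one-forms with a triangular transition matrix *)

Section Lattice.
Variables (P : idomainType) (n : nat).
Local Notation K := {fraction P}.
Local Notation "p %:F" := (@tofrac P p).
Local Notation emb := (@frac_ext P n).
Local Notation y := (ext_var K).
Implicit Types (S T U : {set 'I_n}) (i k s : 'I_n) (j : nat).

Definition int_ext (a : extalg K n) := exists b : extalg P n, a = emb b.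

Lemma int_extD a b : int_ext a -> int_ext b -> int_ext (a + b).
Proof. by move=> [a' ->] [b' ->]; exists (a' + b'); rewrite frac_extD. Qed.

Lemma int_extM a b : int_ext a -> int_ext b -> int_ext (a * b).
Proof. by move=> [a' ->] [b' ->]; exists (a' * b'); rewrite frac_extM. Qed.

Lemma int_extZ c a : int_ext a -> int_ext (c%:F *: a).
Proof. by move=> [a' ->]; exists (c *: a'); rewrite frac_extZ. Qed.

Lemma int_ext_contract i a : int_ext a -> int_ext (ext_contract i a).
Proof. by move=> [a' ->]; exists (ext_contract i a'); rewrite frac_ext_contract. Qed.

Lemma int_extP (a : extalg K n) : (forall S, exists p, a S = p%:F) -> int_ext a.
Proof.
move=> /fin_all_exists[f fE]; exists [ffun S : {set _} => f S].
by apply/ffunP=> S; rewrite fE !ffunE.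
Qed.

Variables (zeta : 'I_n -> extalg K n) (Y : 'I_n -> 'I_n -> P).
Hypothesis zeta_lin :
  forall s, exists c : 'I_n -> K, zeta s = \sum_k c k *: y k.
Hypothesis varE : forall k, y k = \sum_s (Y k s)%:F *: zeta s.
Hypothesis Y_trig : forall k s, (k < s)%N -> Y k s = 0.
Hypothesis Y_diag : forall k, Y k k != 0.
(** Coprimality of [Y i i] to the product of the earlier diagonal entries, phrased by divisibility
    because [P] is only an integral domain. *)
Hypothesis Y_coprime : forall i f g,
  (\prod_(k < n | (k < i)%N) Y k k) * f = Y i i * g -> exists h, f = Y i i * h.

Let L := \prod_k Y k k.
Let Z T := \prod_(i in T) zeta i.

Let L_neq0 : L%:F != 0 :> K.
Proof. by rewrite tofrac_eq0; apply/prodf_neq0=> k _; apply: Y_diag. Qed.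

Let zeta_sqr s : zeta s * zeta s = 0.
Proof. by have [c ->] := zeta_lin s; apply: ext_lin_sqr. Qed.

Let zetaC s t : zeta s * zeta t = - (zeta t * zeta s).
Proof.
by have [c ->] := zeta_lin s; have [d ->] := zeta_lin t; apply: ext_linC.
Qed.

Let ZM S T : Z S * Z T =
  if [disjoint S & T] then (-1) ^+ inversions S T *: Z (S :|: T) else 0.
Proof. exact: anticomm_prodM. Qed.

Let Z1 s : Z [set s] = zeta s.
Proof. exact: big_set1. Qed.

Let Z_homog T : ext_homog #|T| (Z T).
Proof.
rewrite -sum1_card /Z.
elim: (index_enum _) => [|i r IHr].
  by rewrite !big_nil => S; rewrite cards_eq0 ffunE => /negPf ->.
rewrite !big_cons; case: ifP => // _; have [c ->] := zeta_lin i.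
by rewrite add1n; apply: ext_homog_linM.
Qed.

Let init (j : nat) : {set 'I_n} := [set i : 'I_n | (i < j)%N].

Let initS (k : 'I_n) : init k.+1 = init k :|: [set k].
Proof. by apply/setP=> i; rewrite !inE ltnS leq_eqVlt orbC. Qed.

Let init_disjoint k : [disjoint init k & [set k]].
Proof. by rewrite disjoint_sym disjoints1 inE ltnn. Qed.

(** The first [j] of the y_k and of the zeta_k are related by a triangular matrix, so their products
    differ by its determinant. *)
Let basis_init (j : nat) : (j <= n)%N ->
  ext_basis K (init j) = (\prod_(k < n | (k < j)%N) Y k k)%:F *: Z (init j).
Proof.
elim: j => [_|j IHj ltjn].
  have -> : init 0 = set0 by apply/setP=> i; rewrite !inE.
  by rewrite /Z !big_set0 big_pred0 // tofrac1 scale1r.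
pose jo := Ordinal ltjn; have := ext_basisM K (init jo) [set jo].
have := ZM (init jo) [set jo]; rewrite init_disjoint -initS Z1 => eZ eY.
have {eY} : ext_basis K (init jo) * y jo =
    (-1) ^+ inversions (init jo) [set jo] *: ext_basis K (init jo.+1) by [].
(* Only the diagonal term survives: for s > j the entry of [Y] is zero, and for s < j the factor
   zeta_s is repeated. *)
rewrite IHj ?(ltnW ltjn) // varE mulr_sumr (bigD1 jo) //= [X in _ + X]big1 => [|s ne].
  rewrite addr0 -scalerAl -scalerAr eZ !scalerA => eY.
  have := congr1 ( *:%R ((-1) ^+ inversions (init jo) [set jo])) eY.
  rewrite !scalerA -expr2 sqrr_sign scale1r => <-; congr (_ *: _).
  rewrite [in RHS](bigD1 jo) //= rmorphM /=.
  have -> : \prod_(i < n | (i < j.+1)%N && (i != jo)) Y i i =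
            \prod_(i < n | (i < j)%N) Y i i.
    by apply: eq_bigl => i; rewrite ltnS ltn_neqAle andbC -(inj_eq val_inj).
  have := sqrr_sign K (inversions (init j) [set jo]); rewrite expr2 => e.
  by rewrite mulrCA e mulr1 mulrC.
have [lt_js|le_sj] := ltnP j s; first by rewrite Y_trig // tofrac0 scale0r mulr0.
rewrite -scalerAl -scalerAr -Z1 ZM disjoint_sym disjoints1 inE /=.
by rewrite ltn_neqAle le_sj andbT (inj_eq val_inj _ jo) ne !scaler0.
Qed.

Let Z_top T : Z T setT = if T == setT then L%:F^-1 else 0.
Proof.
case: eqP => [->|/eqP ne]; last first.
  apply: Z_homog; apply: contra ne => /eqP e; rewrite eqEcard subsetT.
  by rewrite -e leqnn.
have e : init n = setT by apply/setP=> i; rewrite !inE ltn_ord.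
have := basis_init (leqnn n); rewrite e.
have -> : \prod_(k < n | (k < n)%N) Y k k = L.
  by apply: eq_bigl => k; rewrite ltn_ord.
move/ffunP/(_ setT); rewrite ext_scaleE ffunE eqxx => e1.
by apply: (mulfI L_neq0); rewrite -e1 divff.
Qed.

Let ZM_top T (c : {set 'I_n} -> K) :
  (Z (~: T) * \sum_U c U *: Z U) setT =
  (-1) ^+ inversions (~: T) T * (c T / L%:F).
Proof.
rewrite mulr_sumr sum_ffunE (bigD1 T) //= big1 => [|U ne].
  rewrite addr0 -scalerAr ZM -setI_eq0 setIC setICr eqxx setUC setUCr !ext_scaleE.
  by rewrite Z_top eqxx; ring.
rewrite -scalerAr ext_scaleE ZM; case: ifP => d; last by rewrite ffunE mulr0.
rewrite ext_scaleE Z_top; case: eqP => [e|]; last by rewrite !mulr0.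
case/eqP: ne; apply/setP=> i; move: d; rewrite -setI_eq0 => /eqP/setP/(_ i).
by move/setP/(_ i): e; rewrite !inE; case: (i \in T); case: (i \in U).
Qed.

Lemma frame_independent (c : {set 'I_n} -> K) T : \sum_U c U *: Z U = 0 -> c T = 0.
Proof.
move=> e; have := ZM_top T c; rewrite e mulr0 ffunE => /esym/eqP.
by rewrite mulf_eq0 signr_eq0 mulf_eq0 invr_eq0 (negPf L_neq0) orbF => /eqP.
Qed.

Section Span.
Variable Q : K -> Prop.
Hypothesis Q_tofrac : forall p, Q p%:F.
Hypothesis QD : forall u v, Q u -> Q v -> Q (u + v).
Hypothesis QM : forall u v, Q u -> Q v -> Q (u * v).

Let span (j : nat) (a : extalg K n) := exists c : {set 'I_n} -> K,
  [/\ forall T, Q (c T), forall T, ~~ (T \subset init j) -> c T = 0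
    & a = \sum_T c T *: Z T].

Let Q0 : Q 0. Proof. by rewrite -tofrac0. Qed.
Let Q1 : Q 1. Proof. by rewrite -tofrac1. Qed.

Let span0 j : span j 0.
Proof.
by exists (fun => 0); split=> //; rewrite big1 // => T _; rewrite scale0r.
Qed.

Let spanD j a b : span j a -> span j b -> span j (a + b).
Proof.
move=> [c [Qc sc ->]] [d [Qd sd ->]]; exists (fun T => c T + d T).
split=> [T|T hT|]; [exact: QD | by rewrite sc // sd // addr0 |].
by rewrite -big_split; apply: eq_bigr => T _; rewrite scalerDl.
Qed.

Let spanZ j u a : Q u -> span j a -> span j (u *: a).
Proof.
move=> Qu [c [Qc sc ->]]; exists (fun T => u * c T).
split=> [T|T hT|]; [exact: QM | by rewrite sc // mulr0 |].
by rewrite scaler_sumr; apply: eq_bigr => T _; rewrite scalerA.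
Qed.

Let span_sum j (J : Type) (r : seq J) (a : J -> extalg K n) :
  (forall l, span j (a l)) -> span j (\sum_(l <- r) a l).
Proof. by move=> ha; elim/big_rec: _ => // l b _; apply: spanD. Qed.

Let spanZset j T : T \subset init j -> span j (Z T).
Proof.
move=> hT; exists (fun U => (U == T)%:R); split=> [U|U|].
- by case: eqP.
- by case: eqP => // ->; rewrite hT.
rewrite (bigD1 T) //= eqxx scale1r big1 ?addr0 // => U /negPf ->.
by rewrite scale0r.
Qed.

Let span_zetaM (j : nat) s a : (s < j)%N -> span j a -> span j (zeta s * a).
Proof.
move=> sj [c [Qc sc ->]]; rewrite mulr_sumr; apply: span_sum => T.
rewrite -scalerAr; have [hT|/sc->] := boolP (T \subset init j); last first.
  by rewrite scale0r.
apply: spanZ => //; rewrite -Z1 ZM; case: ifP => _ //.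
apply: spanZ; last by apply: spanZset; rewrite subUset hT sub1set inE sj.
rewrite -(rmorph_sign (@tofrac P)); exact: Q_tofrac.
Qed.

Let span_varM (j : nat) k a : (k < j)%N -> span j a -> span j (y k * a).
Proof.
move=> kj ha; rewrite varE mulr_suml; apply: span_sum => s.
rewrite -scalerAl; have [ks|sk] := ltnP k s.
  by rewrite Y_trig // tofrac0 scale0r.
by apply: spanZ => //; apply: span_zetaM => //; apply: leq_ltn_trans kj.
Qed.

(** Each y_k is a [P]-combination of the zeta_s with s <= k, so the [Q]-span of the zeta_T is stable
    under multiplication by y_k. [Q] is kept abstract because the section is applied both to the
    image of [P] and to the whole fraction field. *)
Lemma frame_span (j : nat) (a : extalg K n) : (forall S, Q (a S)) -> ext_below j a ->
  exists c : {set 'I_n} -> K,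
  [/\ forall T, Q (c T),
      forall T, ~~ (T \subset [set i : 'I_n | (i < j)%N]) -> c T = 0
    & a = \sum_T c T *: \prod_(i in T) zeta i].
Proof.
move=> Qa ha; change (span j a); move: ha; apply: (@ext_below_ind _ _ j a (span j)) => //.
- exact: spanD.
- by move=> S b; apply: spanZ.
- by have := spanZset (sub0set (init j)); rewrite /Z big_set0.
by move=> k b; apply: span_varM.
Qed.

Lemma basisM_frame_span S T : exists2 c : {set 'I_n} -> K,
  forall U, Q (c U) & ext_basis K S * Z T = \sum_U c U *: Z U.
Proof.
suff : span n (ext_basis K S * Z T) by case=> c [Qc _ e]; exists c.
rewrite ext_basis_prod; elim: (index_enum _) => [|k r IHr].
  by rewrite big_nil mul1r; apply: spanZset; apply/subsetP=> i; rewrite inE.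
by rewrite big_cons; case: ifP => // _; rewrite -mulrA; apply: span_varM.
Qed.

End Span.

(** The coefficient of zeta_T at S is, up to sign, the top coefficient of y_(~: S) zeta_T. The
    latter is a [P]-combination of the zeta_U, of which only the full product reaches top degree,
    with coefficient 1 / L. *)
Lemma frame_integral T : int_ext (L%:F *: \prod_(i in T) zeta i).
Proof.
rewrite -/(Z T); apply: int_extP => S; rewrite ext_scaleE.
pose Q (u : K) := exists p, u = p%:F.
have [|||c Qc e] := @basisM_frame_span Q _ _ _ (~: S) T.
- by move=> p; exists p.
- by move=> _ _ [p ->] [p' ->]; exists (p + p'); rewrite rmorphD.
- by move=> _ _ [p ->] [p' ->]; exists (p * p'); rewrite rmorphM.
have := ext_basisM_top S (Z T); rewrite e sum_ffunE (bigD1 setT) //= big1 => [|U ne].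
  rewrite addr0 ext_scaleE Z_top eqxx; have [p ->] := Qc setT => e1.
  have := sqrr_sign K (inversions (~: S) S); rewrite expr2 => e2.
  exists ((-1) ^+ inversions (~: S) S * p); rewrite rmorphM rmorph_sign /=.
  have -> : Z T S = (-1) ^+ inversions (~: S) S * (p%:F / L%:F).
    by rewrite e1 mulrA e2 mul1r.
  by rewrite mulrCA [L%:F * _]mulrCA divff // mulr1.
by rewrite ext_scaleE Z_top (negPf ne) mulr0.
Qed.

Lemma frame_integralM S T :
  int_ext (L%:F *: ((\prod_(i in S) zeta i) * \prod_(i in T) zeta i)).
Proof.
rewrite -/(Z S) -/(Z T) ZM; case: ifP => _; last by exists 0; rewrite scaler0 frac_ext0.
rewrite scalerA mulrC -scalerA -(rmorph_sign (@tofrac P)).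
exact/int_extZ/frame_integral.
Qed.

Let contract_zeta_gt s i : (s < i)%N -> ext_contract i (zeta s) = 0.
Proof.
have [m] := ubnP (s : nat); elim: m s => // m IHm s; rewrite ltnS => sm si.
have := congr1 (ext_contract i) (varE s); rewrite ext_contract_var.
have -> : (i == s) = false by apply/eqP=> e; rewrite e ltnn in si.
rewrite scale0r linear_sum (bigD1 s) //= big1 => [|r ne].
  rewrite addr0 linearZ /= => /(congr1 ( *:%R ((Y s s)%:F^-1))).
  by rewrite scaler0 scalerA mulVf ?tofrac_eq0 // scale1r.
have [lt_sr|le_rs] := ltnP s r; first by rewrite Y_trig // tofrac0 scale0r linear0.
have lt_rs : (r < s)%N by rewrite ltn_neqAle le_rs andbT.
rewrite linearZ /= IHm ?scaler0 //; [exact: leq_trans lt_rs sm | exact: ltn_trans lt_rs si].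
Qed.

Let contract_zeta i : (Y i i)%:F *: ext_contract i (zeta i) = 1.
Proof.
have := congr1 (ext_contract i) (varE i).
rewrite ext_contract_var eqxx scale1r linear_sum (bigD1 i) //= big1 => [|r ne].
  by rewrite addr0 linearZ /= => ->.
have [lt_ir|le_ri] := ltnP i r; first by rewrite Y_trig // tofrac0 scale0r linear0.
by rewrite linearZ /= contract_zeta_gt ?scaler0 // ltn_neqAle le_ri andbT.
Qed.

(* [a = Y i i *: (ext_contract i (zeta i * a) + zeta i * ext_contract i a)],   *)
(* because [Y i i *: zeta i] contracts to [1].                                 *)
Let diag_dvd_frameM i T a : int_ext a -> int_ext (zeta i * a) ->
  exists2 b, int_ext b & L%:F *: (Z T * a) = (Y i i)%:F *: b.
Proof.
move=> ha hza; have [c zE] := zeta_lin i.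
have := ext_contract_linM i c a; rewrite -zE => ec.
have ea : a = (Y i i)%:F *:
    (ext_contract i (zeta i * a) + zeta i * ext_contract i a).
  by rewrite ec subrK scalerAl contract_zeta mul1r.
exists ((L%:F *: Z T) * ext_contract i (zeta i * a) +
        (L%:F *: (Z T * zeta i)) * ext_contract i a).
  apply: int_extD; apply: int_extM; try exact: int_ext_contract.
    exact: frame_integral.
  by rewrite -Z1; apply: frame_integralM.
rewrite {1}ea -!scalerAr !scalerA [L%:F * _]mulrC -scalerA; congr (_ *: _).
  by rewrite mulrDr scalerDr !mulrA -!scalerAl.
Qed.

Let prod_dvd f : (forall i, exists g, f = Y i i * g) -> exists g, f = L * g.
Proof.
move=> fD; suff /(_ n (leqnn n)) [g ->]: forall j, (j <= n)%N ->
    exists g, f = (\prod_(k < n | (k < j)%N) Y k k) * g.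
  by exists g; congr (_ * _); apply: eq_bigl => k; rewrite ltn_ord.
elim=> [_|j IHj ltjn]; first by exists f; rewrite big_pred0 ?mul1r.
have [g eg] := IHj (ltnW ltjn); pose jo := Ordinal ltjn.
have [h eh] := fD jo; have [h' eh'] := @Y_coprime jo g h (etrans (esym eg) eh).
exists h'; rewrite eg eh' mulrA; congr (_ * _).
rewrite [RHS](bigD1 jo) //= mulrC; congr (_ * _).
by apply: eq_bigl => i; rewrite ltnS ltn_neqAle andbC -(inj_eq val_inj).
Qed.

(** Each [Y i i] divides the integral form L zeta_T a, hence so does L by coprimality, and every
    zeta_T a is integral. The top coefficient of zeta_(~: T) a is, up to sign, the coefficient of
    [a] at zeta_T divided by L; so that coefficient lies in L [P]. *)
Lemma frame_decomposition (j : nat) (a : extalg P n) : ext_below j a ->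
  (forall s, int_ext (zeta s * emb a)) ->
  exists2 c : {set 'I_n} -> P,
    forall T, ~~ (T \subset [set i : 'I_n | (i < j)%N]) -> c T = 0
    & emb a = L%:F *: \sum_T (c T)%:F *: \prod_(i in T) zeta i.
Proof.
move=> ja hza; have ha : int_ext (emb a) by exists a.
have hZ T : int_ext (Z T * emb a).
  have [b eb] : exists b : extalg P n, L%:F *: (Z T * emb a) = emb b.
    have [b hb] := frame_integral T.
    by exists (b * a); rewrite frac_extM -hb scalerAl.
  have /fin_all_exists[g eg] S : exists g, b S = L * g.
    apply: prod_dvd => i; have [_ [d ->] ed] := diag_dvd_frameM T ha (hza i).
    exists (d S); apply: tofrac_inj.
    by have /ffunP/(_ S) := etrans (esym eb) ed; rewrite ext_scaleE !frac_extE rmorphM.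
  exists [ffun S : {set _} => g S]; apply: (scalerI L_neq0).
  by rewrite eb -frac_extZ; congr frac_ext; apply/ffunP=> S; rewrite ext_scaleE ffunE.
have [|||||c [_ c0 ea]] := @frame_span (fun => True) _ _ _ j (emb a) _.
- by [].
- by [].
- by [].
- by [].
- exact: frac_ext_below.
have /fin_all_exists[d ed] T : exists d, c T = L%:F * d%:F.
  have [b eb] := hZ (~: T); have := ZM_top T c; rewrite -ea eb frac_extE => e.
  exists ((-1) ^+ inversions (~: T) T * b setT).
  have := sqrr_sign K (inversions (~: T) T); rewrite expr2 => e2.
  rewrite rmorphM rmorph_sign /= e [(-1) ^+ _ * (_ * _)]mulrA e2 mul1r.
  by rewrite mulrCA divff // mulr1.
exists d; last by rewrite ea scaler_sumr; apply: eq_bigr => T _; rewrite ed scalerA.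
move=> T /c0; rewrite ed => /eqP; rewrite mulf_eq0 (negPf L_neq0) /= tofrac_eq0.
by move/eqP.
Qed.

End Lattice.

(** * Shift-invariant polynomials *)

Section ShiftInvariant.
Variables (P : idomainType) (L : P).
Implicit Types (d p r N : {poly P}) (w : P).

Local Notation shift w := ('X + w%:P).

Lemma size_shift w : size (shift w : {poly P}) = 2.
Proof. by rewrite size_polyDl size_polyX // size_polyC; case: (w == 0). Qed.

(** Invariance at 0 gives r(w) = r(0), so r - r(0) has too many roots for its degree. *)
Lemma shift_invariant_const (W : seq P) r : uniq W -> (size r <= size W)%N ->
  (forall w, w \in W -> r \Po shift w = r) -> r = (r.[0])%:P.
Proof.
move=> Wu rW rinv; apply/eqP; rewrite -subr_eq0; apply: contraTT rW => nz.
have W_root : all (root (r - (r.[0])%:P)) W.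
  apply/allP=> w /rinv e; rewrite /root !hornerE -{1}[w]add0r.
  by rewrite -[X in _ - X.[0]]e horner_comp !hornerE subrr.
have := max_poly_roots nz W_root Wu; rewrite -ltnNge => /leq_trans; apply.
have [r0|rn0] := eqVneq r 0; first by rewrite r0 horner0 subr0 size_poly0 in nz *.
rewrite (leq_trans (size_polyD _ _)) // geq_max leqnn size_polyN size_polyC.
by rewrite (leq_trans (leq_b1 _)) // lt0n size_poly_eq0.
Qed.

(** Uniqueness of division with remainder by a monic polynomial. *)
Lemma shift_invariant_divmod N w d : N \is monic -> (1 < size N)%N ->
  N \Po shift w = N -> d \Po shift w = d ->
  Pdiv.Ring.rdivp d N \Po shift w = Pdiv.Ring.rdivp d N /\
  Pdiv.Ring.rmodp d N \Po shift w = Pdiv.Ring.rmodp d N.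
Proof.
move=> mN N1 Nw dw; set e := Pdiv.Ring.rdivp d N; set r := Pdiv.Ring.rmodp d N.
have ed : d = e * N + r by apply: Pdiv.RingMonic.rdivp_eq.
have ed' : d = (e \Po shift w) * N + (r \Po shift w).
  by rewrite -{1}dw {1}ed comp_polyD comp_polyM Nw.
have sr : (size (r \Po shift w)%R < size N)%N.
  by rewrite size_comp_poly2 ?size_shift // Pdiv.Ring.ltn_rmodp monic_neq0.
split; first by rewrite {2}/e ed' Pdiv.RingMonic.rdivp_addl_mul_small.
by rewrite {2}/r ed' Pdiv.RingMonic.rmodp_addl_mul_small.
Qed.

Let dvdL (a : P) := exists b, a = L * b.

Let dvdLD a b : dvdL a -> dvdL b -> dvdL (a + b).
Proof. by move=> [c ->] [d ->]; exists (c + d); rewrite mulrDr. Qed.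

Let dvdLM a b : dvdL a -> dvdL (a * b).
Proof. by move=> [c ->]; exists (c * b); rewrite mulrA. Qed.

Let dvdLN a : dvdL a -> dvdL (- a).
Proof. by rewrite -mulrN1; apply: dvdLM. Qed.

Variables (k : nat) (p : 'I_k -> {poly P}).
Hypothesis p_monic : forall i, p i \is monic.
Hypothesis p_size : forall i j : 'I_k, (i < j)%N -> (size (p i) < size (p j))%N.

(** Downward induction on [i]: at the degree of [p i] only [r i] and multiples of the [r j] with j >
    i contribute, and the latter are already divisible by [L]. *)
Let const_dvd (r : 'I_k -> P) h : \sum_i (r i)%:P * p i = L%:P * h ->
  forall i, dvdL (r i).
Proof.
move=> e i; have [m] := ubnP (k - i); elim: m i => // m IHm i; rewrite ltnS => im.
have := congr1 (fun u : {poly P} => u`_((size (p i)).-1)) e.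
rewrite coef_sum coefCM (bigD1 i) //= coefCM.
have -> : (p i)`_(size (p i)).-1 = 1 by apply/monicP/p_monic.
rewrite mulr1 => /(canRL (addrK _)) ->; apply: dvdLD; first by exists h`_(size (p i)).-1.
apply: dvdLN; elim/big_rec: _ => [|j a ne ha]; first by exists 0; rewrite mulr0.
apply: dvdLD => //; rewrite coefCM; case: (ltngtP i j) => [lt_ij|lt_ji|/val_inj e'].
- by apply/dvdLM/IHm; have := ltn_ord j; lia.
- rewrite nth_default ?mulr0; first by exists 0; rewrite mulr0.
  by have := p_size lt_ji; case: (size (p i)).
by rewrite e' eqxx in ne.
Qed.

(* Divide all the [d i] by [N]: the remainders are shift-invariant of size at *)
(* most [size W], hence constant, and the quotients are again invariant.      *)
Lemma shift_invariant_dvd (W : seq P) N (d : 'I_k -> {poly P}) h :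
  uniq W -> (0 < size W)%N -> (forall i, (size (p i) <= size W)%N) ->
  N \is monic -> size N = (size W).+1 ->
  (forall w, w \in W -> N \Po shift w = N) ->
  (forall i w, w \in W -> d i \Po shift w = d i) ->
  \sum_i d i * p i = L%:P * h -> forall i, exists g, d i = L%:P * g.
Proof.
move=> Wu W0 pW mN sN Ninv; have [m dm] : exists m, forall i, (size (d i) <= m)%N.
  by exists (\max_i size (d i))%N => i; apply: leq_bigmax.
elim: m d h dm => [|m IHm] d h dm dinv e.
  by move=> i; exists 0; rewrite mulr0; apply/eqP; rewrite -size_poly_leq0 dm.
pose quo i := Pdiv.Ring.rdivp (d i) N; pose rem i := Pdiv.Ring.rmodp (d i) N.
have ed i : d i = quo i * N + rem i by apply: Pdiv.RingMonic.rdivp_eq.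
have N1 : (1 < size N)%N by rewrite sN.
have nzN : N != 0 by apply: monic_neq0.
have inv i w : w \in W -> quo i \Po shift w = quo i /\ rem i \Po shift w = rem i.
  by move=> wW; apply: shift_invariant_divmod; rewrite ?Ninv ?dinv.
have remW i : (size (rem i) <= size W)%N by rewrite -ltnS -sN Pdiv.Ring.ltn_rmodp.
have remC i : rem i = ((rem i).[0])%:P.
  by apply: (shift_invariant_const Wu) => // w /inv -/(_ i)[].
have e1 : \sum_i d i * p i =
    (\sum_i quo i * p i) * N + \sum_i ((rem i).[0])%:P * p i.
  rewrite mulr_suml -big_split; apply: eq_bigr => i _ /=.
  by rewrite -remC {1}(ed i); ring.
have e2 : L%:P * h = (L%:P * Pdiv.Ring.rdivp h N) * N + L%:P * Pdiv.Ring.rmodp h N.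
  by rewrite {1}(Pdiv.RingMonic.rdivp_eq mN h); ring.
have s1 : (size (\sum_i ((rem i).[0])%:P * p i)%R < size N)%N.
  rewrite sN ltnS; apply: (big_ind (fun u : {poly P} => (size u <= size W)%N)).
  - by rewrite size_poly0.
  - by move=> u v hu hv; rewrite (leq_trans (size_polyD _ _)) // geq_max hu.
  by move=> i _; rewrite mul_polyC (leq_trans (size_scale_leq _ _)).
have s2 : (size (L%:P * Pdiv.Ring.rmodp h N)%R < size N)%N.
  by rewrite mul_polyC (leq_ltn_trans (size_scale_leq _ _)) // Pdiv.Ring.ltn_rmodp.
(* Both sides of [e] are now written as a multiple of [N] plus a term of size below that of [N], so
   quotients and remainders agree separately. *)
have eQ : \sum_i quo i * p i = L%:P * Pdiv.Ring.rdivp h N.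
  have := congr1 (fun u : {poly P} => Pdiv.Ring.rdivp u N) e; rewrite e1 e2.
  by rewrite !Pdiv.RingMonic.rdivp_addl_mul_small.
have eR : \sum_i ((rem i).[0])%:P * p i = L%:P * Pdiv.Ring.rmodp h N.
  have := congr1 (fun u : {poly P} => Pdiv.Ring.rmodp u N) e; rewrite e1 e2.
  by rewrite !Pdiv.RingMonic.rmodp_addl_mul_small.
(* [N] has degree [size W], which is positive, so the quotients are strictly smaller and the
   induction on size applies. *)
have quo_size i : (size (quo i) <= (size (d i)).-1)%N.
  have [->|nq] := eqVneq (quo i) 0; first by rewrite size_poly0.
  have sQN : size (quo i * N) = (size (quo i) + size W)%N.
    by rewrite size_Mmonic // sN addnS.
  rewrite [in X in (_ <= X)%N](ed i) size_polyDl sQN; first by lia.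
  by rewrite (leq_ltn_trans (remW i)) // -[X in (X < _)%N]add0n ltn_add2r lt0n size_poly_eq0.
move=> i; have [s es] := const_dvd eR i.
have [||g eg] := IHm quo _ _ _ eQ i.
- move=> l; apply: leq_trans (quo_size l) _; have := dm l.
  by case: (size (d l)).
- by move=> l w /inv -/(_ l)[].
by exists (g * N + s%:P); rewrite (ed i) remC es eg polyCM; ring.
Qed.

End ShiftInvariant.

(** * The additive polynomials of the standard flag *)

Lemma eq_rmorph_mpoly (n : nat) (R S : nzRingType)
    (f g : {rmorphism {mpoly R[n]} -> S}) :
  (forall c, f c%:MP = g c%:MP) -> (forall i, f 'X_i = g 'X_i) -> f =1 g.
Proof.
move=> eqC eqX p; rewrite [p]mpolyE !rmorph_sum; apply: eq_bigr => m _ /=.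
rewrite -mul_mpolyC !rmorphM /= eqC; congr (_ * _).
rewrite mpolyXE_id !rmorph_prod; apply: eq_bigr => i _ /=.
by rewrite !rmorphXn /= eqX.
Qed.

Section Frobenius.
Variables (F : finFieldType).

(** [h] transports the characteristic of [F] to [R], where the q-th power is an iterated
    Frobenius. *)
Lemma exprD_card (R : comNzRingType) (h : {rmorphism F -> R}) (a b : R) :
  (a + b) ^+ #|F| = a ^+ #|F| + b ^+ #|F|.
Proof.
have [p p_pr pF] := finPcharP F.
have [d cF] : exists d, #|F| = (p ^ d)%N.
  by exists (logn p #|F|); apply: (card_pprimeChar pF).
apply: exprDn_pchar; rewrite cF; apply/andP; split; first by rewrite expn_gt0 prime_gt0.
apply/allP=> r; rewrite mem_primes => /and3P[r_pr _].
rewrite Euclid_dvdX // => /andP[]; rewrite dvdn_prime2 // => /eqP -> _; rewrite !inE p_pr /=.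
have := rmorph_nat h p; rewrite (pcharf0 pF) rmorph0 => <-.
by rewrite eqxx.
Qed.

End Frobenius.

Section LinearizedPolynomials.
Variables (F : finFieldType) (n : nat).
Local Notation P := {mpoly F[n]}.
Local Notation q := #|F|.
Implicit Types (f g : P) (i k m s : nat) (c : nat -> F) (j : 'I_n).

(* Equal to 0 when k is not smaller than n. *)
Definition mvar k : P := if insub k is Some i then 'X_(i : 'I_n) else 0.

Lemma mvarE j : mvar j = 'X_j. Proof. by rewrite /mvar valK. Qed.

Definition flag_elt m c : P := \sum_(i < m) c i *: mvar i.

(* The additive polynomial whose roots are the linear forms in the first i *)
(* variables.                                                             *)
Fixpoint flag_poly i : {poly P} :=
  if i is i'.+1 then
    flag_poly i' ^+ q
      - ((flag_poly i').[mvar i'] ^+ q.-1)%:P * flag_poly i'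
  else 'X.

Let q_gt1 : (1 < q)%N. Proof. exact: finNzRing_gt1. Qed.
Let q_gt0 : (0 < q)%N. Proof. exact: ltnW. Qed.

Let polyD_card (a b : {poly P}) : (a + b) ^+ q = a ^+ q + b ^+ q.
Proof. exact: (exprD_card (polyC \o @mpolyC n F)). Qed.

Lemma flag_poly_compS i h : flag_poly i.+1 \Po h = (flag_poly i \Po h) ^+ q
   - ((flag_poly i).[mvar i] ^+ q.-1)%:P * (flag_poly i \Po h).
Proof. by rewrite /= comp_polyB comp_polyM comp_polyC rmorphXn. Qed.

Lemma flag_poly_hornerS i f : (flag_poly i.+1).[f] =
  (flag_poly i).[f] ^+ q - (flag_poly i).[mvar i] ^+ q.-1 * (flag_poly i).[f].
Proof. by rewrite /= !(hornerE, horner_exp). Qed.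

Lemma flag_poly_compD i (a b : {poly P}) :
  flag_poly i \Po (a + b) = (flag_poly i \Po a) + (flag_poly i \Po b).
Proof.
elim: i => [|i IHi]; first by rewrite /= !comp_polyX.
by rewrite !flag_poly_compS IHi polyD_card; ring.
Qed.

Lemma flag_poly_hornerD i f g :
  (flag_poly i).[f + g] = (flag_poly i).[f] + (flag_poly i).[g].
Proof.
by apply: polyC_inj; rewrite polyCD -!comp_polyCr polyCD flag_poly_compD.
Qed.

Lemma flag_poly_hornerZ i (a : F) f : (flag_poly i).[a *: f] = a *: (flag_poly i).[f].
Proof.
elim: i => [|i IHi]; first by rewrite /= !hornerX.
by rewrite !flag_poly_hornerS IHi exprZn expf_card scalerBr -scalerAr.
Qed.

Lemma flag_poly_horner0 i : (flag_poly i).[0] = 0.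
Proof. by rewrite -[0 in LHS](scale0r 0) flag_poly_hornerZ scale0r. Qed.

Lemma flag_poly_horner_sum i m c :
  (flag_poly i).[flag_elt m c] = \sum_(k < m) c k *: (flag_poly i).[mvar k].
Proof.
rewrite /flag_elt.
elim/big_rec2: _ => [|k f g _ <-]; first exact: flag_poly_horner0.
by rewrite flag_poly_hornerD flag_poly_hornerZ.
Qed.

Lemma flag_poly_mvar_lt i k : (k < i)%N -> (flag_poly i).[mvar k] = 0.
Proof.
elim: i => // i IHi; rewrite ltnS leq_eqVlt flag_poly_hornerS.
case/orP=> [/eqP ->|/IHi ->]; first by rewrite -exprSr prednK // subrr.
by rewrite expr0n eqn0Ngt q_gt0 mulr0 subr0.
Qed.

Lemma flag_poly_flag_elt i m c : (m <= i)%N -> (flag_poly i).[flag_elt m c] = 0.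
Proof.
move=> mi; rewrite flag_poly_horner_sum big1 // => k _.
by rewrite flag_poly_mvar_lt ?scaler0 // (leq_trans _ mi).
Qed.

Lemma flag_poly_shift i m c : (m <= i)%N ->
  flag_poly i \Po ('X + (flag_elt m c)%:P) = flag_poly i.
Proof.
move=> mi; rewrite flag_poly_compD comp_polyXr comp_polyCr.
by rewrite flag_poly_flag_elt // addr0.
Qed.

Lemma flag_poly_monic_size i :
  flag_poly i \is monic /\ size (flag_poly i) = (q ^ i).+1.
Proof.
elim: i => [|i [mi si]]; first by rewrite /= monicX size_polyX.
have sX : size (flag_poly i ^+ q) = (q ^ i.+1).+1.
  have := size_exp (flag_poly i) q; rewrite si /= -expnSr => <-.
  by rewrite prednK // size_poly_gt0 monic_neq0 // monic_exp.
have lt_s : (size (- (((flag_poly i).[mvar i] ^+ q.-1)%:P * flag_poly i))%R <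
             size (flag_poly i ^+ q))%N.
  rewrite size_polyN mul_polyC (leq_ltn_trans (size_scale_leq _ _)) // sX si ltnS.
  by rewrite ltn_exp2l.
split; last by rewrite /= size_polyDl.
by rewrite monicE /= lead_coefDl // -monicE monic_exp.
Qed.

(** The coefficients of N_i are built from the N_k(x_k) with k < i. These are fixed, because [h]
    changes x_k by a linear form in earlier variables, which N_k sends to zero. *)
Lemma flag_poly_act (h : {rmorphism P -> P}) m :
  (forall k, (k < m)%N ->
    exists l c, (l <= k)%N /\ h (mvar k) = mvar k + flag_elt l c) ->
  forall i f, (i <= m)%N -> h (flag_poly i).[f] = (flag_poly i).[h f].
Proof.
move=> hx; elim=> [|i IHi] f im; first by rewrite /= !hornerX.
rewrite !flag_poly_hornerS rmorphB rmorphM !rmorphXn /=.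
rewrite !(IHi _ (ltnW im)).
have [l [c [li ->]]] := hx i im.
by rewrite flag_poly_hornerD (flag_poly_flag_elt _ li) addr0.
Qed.

(** The Moore determinant of x_0, ..., x_(m-1) in factored form; it serves as common denominator of
    the theta_s with s < m. *)
Definition flag_disc m : P := \prod_(i < m) (flag_poly i).[mvar i].

(** * Polynomials regarded as univariate in one of the variables *)

Section Univariate.
Variable j : 'I_n.

Let uni_var (k : 'I_n) : {poly P} := if k == j then 'X else ('X_k)%:P.

(* Turns 'X_j into the variable of a univariate polynomial and keeps the *)
(* other variables as constants.                                         *)
Definition uni : P -> {poly P} := mmap (polyC \o @mpolyC n F) uni_var.
HB.instance Definition _ := GRing.RMorphism.copy uni
  (mmap (polyC \o @mpolyC n F) uni_var).

Lemma uniC (c : F) : uni c%:MP = c%:MP%:P.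
Proof. exact: mmapC. Qed.

Lemma uniX (k : 'I_n) : uni 'X_k = if k == j then 'X else ('X_k)%:P.
Proof. by rewrite /uni mmapX mmap1U. Qed.

Lemma uniZ (c : F) f : uni (c *: f) = c%:MP%:P * uni f.
Proof. by rewrite -mul_mpolyC rmorphM /= uniC. Qed.

Lemma uni_mvar k : k != j -> uni (mvar k) = (mvar k)%:P.
Proof.
rewrite /mvar; case: insubP => [i _ <- ne|_ _]; last exact: rmorph0.
by rewrite uniX -(inj_eq val_inj) (negPf ne).
Qed.

Lemma uni_flag_elt m c : (m <= j)%N -> uni (flag_elt m c) = (flag_elt m c)%:P.
Proof.
move=> mj; rewrite /flag_elt !rmorph_sum; apply: eq_bigr => k _ /=.
rewrite uniZ uni_mvar ?neq_ltn ?(leq_trans _ mj) // -mul_mpolyC.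
by rewrite polyCM.
Qed.

Lemma uniK f : (uni f).['X_j] = f.
Proof.
apply: (@eq_rmorph_mpoly _ _ _ (horner_eval ('X_j : P) \o uni) idfun) => [c|k] /=.
  by rewrite uniC /horner_eval hornerC.
by rewrite uniX /horner_eval; case: eqP => [->|_]; rewrite ?hornerX ?hornerC.
Qed.

Lemma uni_shift (h : {rmorphism P -> P}) (w : P) :
  (forall c : F, h c%:MP = c%:MP) ->
  (forall k : 'I_n, h 'X_k = 'X_k + (if k == j then w else 0)) ->
  uni w = w%:P -> forall f, uni f \Po ('X + w%:P) = uni (h f).
Proof.
move=> hC hX uw; apply: (@eq_rmorph_mpoly _ _ _
  (comp_poly ('X + w%:P) \o uni) (uni \o h)) => [c|k] /=.
  by rewrite hC uniC comp_polyC.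
rewrite hX rmorphD /= uniX; case: eqP => [_|_].
  by rewrite comp_polyX uw.
by rewrite comp_polyC rmorph0 addr0.
Qed.

(** For i <= j the coefficients of N_i involve only variables before x_j, which [uni] keeps as
    constants. *)
Lemma uni_flag_poly i f : (i <= j)%N ->
  uni (flag_poly i).[f] = flag_poly i \Po uni f.
Proof.
elim: i f => [|i IHi] f ij; first by rewrite /= !comp_polyX hornerX.
rewrite flag_poly_hornerS flag_poly_compS rmorphB rmorphM !rmorphXn /=.
by rewrite !IHi ?(ltnW ij) // uni_mvar ?neq_ltn ?ij // comp_polyCr.
Qed.

Lemma uni_flag_disc m : (m <= j)%N -> uni (flag_disc m) = (flag_disc m)%:P.
Proof.
move=> mj; rewrite /flag_disc !rmorph_prod; apply: eq_bigr => i _ /=.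
have ij : (i < j)%N by apply: leq_trans mj.
by rewrite uni_flag_poly ?(ltnW ij) // uni_mvar ?neq_ltn ?ij // comp_polyCr.
Qed.

Lemma flag_poly_mvar_neq0 : (flag_poly j).[mvar j] != 0.
Proof.
have [mon _] := flag_poly_monic_size j; apply: contra (monic_neq0 mon) => /eqP e.
have := uni_flag_poly (mvar j) (leqnn j).
by rewrite e rmorph0 mvarE uniX eqxx comp_polyXr => <-.
Qed.

End Univariate.

Lemma flag_disc_neq0 m : (m <= n)%N -> flag_disc m != 0.
Proof.
move=> mn; apply/prodf_neq0=> i _.
exact: (flag_poly_mvar_neq0 (widen_ord mn i)).
Qed.

(** As polynomials in x_j, N_j(x_j) is monic and [flag_disc j] is a nonzero constant; hence the
    remainder of [f] modulo N_j is zero. *)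
Lemma flag_disc_coprime j f g :
  flag_disc j * f = (flag_poly j).[mvar j] * g ->
  exists h, f = (flag_poly j).[mvar j] * h.
Proof.
have [mon _] := flag_poly_monic_size j.
move/(congr1 (uni j)); rewrite !rmorphM /= (uni_flag_disc (leqnn j)).
rewrite (uni_flag_poly _ (leqnn j)).
rewrite mvarE uniX eqxx comp_polyXr => e.
set N := flag_poly j in mon e *.
pose u := Pdiv.Ring.rdivp (uni j f) N; pose r := Pdiv.Ring.rmodp (uni j f) N.
have ef : uni j f = u * N + r by apply: Pdiv.RingMonic.rdivp_eq.
have r0 : r = 0.
  have nzN := monic_neq0 mon.
  have e1 : uni j g * N + 0 = ((flag_disc j)%:P * u) * N + (flag_disc j)%:P * r.
    by rewrite addr0 mulrC -e ef; ring.
  have := congr1 (fun v : {poly P} => Pdiv.Ring.rmodp v N) e1.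
  have s1 : (size (0 : {poly P})%R < size N)%N.
    by rewrite size_poly0 size_poly_gt0.
  have s2 : (size ((flag_disc j)%:P * r)%R < size N)%N.
    rewrite mul_polyC; apply: leq_ltn_trans (size_scale_leq _ _) _.
    by rewrite Pdiv.Ring.ltn_rmodp.
  rewrite (Pdiv.RingMonic.rmodp_addl_mul_small mon _ s1).
  rewrite (Pdiv.RingMonic.rmodp_addl_mul_small mon _ s2).
  move/esym/eqP; rewrite mulf_eq0 polyC_eq0.
  by rewrite (negPf (flag_disc_neq0 (ltnW (ltn_ord j)))) => /eqP.
exists u.['X_j].
by rewrite -[LHS](uniK j) ef r0 addr0 mulrC hornerM.
Qed.

(** * Transvections and divisibility *)

Definition transvection j m c : 'M[F]_n :=
  \matrix_(i, k) ((i == k)%:R + ((k == j) && (i < m)%N)%:R * c i).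

Lemma sum_flag_elt m c : (m <= n)%N ->
  \sum_(i < n) ((i < m)%N%:R * c i) *: 'X_i = flag_elt m c.
Proof.
move=> mn; rewrite /flag_elt (big_ord_widen n (fun i => c i *: mvar i) mn).
rewrite [RHS]big_mkcond; apply: eq_bigr => i _; rewrite mvarE.
by case: ifP; rewrite ?mul1r // mul0r scale0r.
Qed.

Lemma mpoly_act_transvection j m c (k : 'I_n) : (m <= n)%N ->
  mpoly_act (transvection j m c) 'X_k =
    'X_k + (if k == j then flag_elt m c else 0).
Proof.
move=> mn; rewrite mpoly_actX.
under eq_bigr => i _ do rewrite mxE scalerDl.
rewrite big_split /= (bigD1 k) //= eqxx scale1r big1 ?addr0 => [|i /negPf ->].
  case: eqP => _; first by rewrite sum_flag_elt.
  by rewrite big1 // => i _; rewrite mul0r scale0r.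
by rewrite scale0r.
Qed.

Let extend m (c : {ffun 'I_m -> F}) (i : nat) : F :=
  if insub i is Some i' then c i' else 0.

Let flag_elts m : seq P := [seq flag_elt m (extend c) | c : {ffun 'I_m -> F}].

Let size_flag_elts m : size (flag_elts m) = (q ^ m)%N.
Proof. by rewrite size_map -cardE card_ffun card_ord. Qed.

Let flag_elts_uniq m : (m <= n)%N -> uniq (flag_elts m).
Proof.
move=> mn; rewrite map_inj_uniq ?enum_uniq // => c d e.
apply/ffunP=> i; have := congr1 (mcoeff U_(widen_ord mn i)) e.
have coefE (u : {ffun 'I_m -> F}) :
    (flag_elt m (extend u))@_U_(widen_ord mn i) = u i.
  rewrite -sum_flag_elt // raddf_sum (bigD1 (widen_ord mn i)) //= big1 => [|k ne].
    rewrite mcoeffZ mcoeffX eqxx mulr1 addr0 ltn_ord mul1r /extend.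
    by rewrite insubT //= => p; congr (u _); apply: val_inj.
  by rewrite mcoeffZ mcoeffX eq_mnm1 (negPf ne) mulr0.
by rewrite !coefE.
Qed.

(** This is [shift_invariant_dvd] in the variable x_j: the shifts are the q^m linear forms in the
    first [m] variables, the modulus is N_m of degree q^m, and the monic polynomials are 1, N_0,
    ..., N_(m-1), of degrees 0, 1, q, ..., q^(m-1). *)
Lemma transvection_invariant_dvd j m (d0 : P) (d : 'I_m -> P) (L h : P) :
  (m <= j)%N -> uni j L = L%:P ->
  (forall c, mpoly_act (transvection j m c) d0 = d0) ->
  (forall c (s : 'I_m), mpoly_act (transvection j m c) (d s) = d s) ->
  d0 + \sum_(s < m) (flag_poly s).[mvar j] * d s = L * h ->
  (exists g, d0 = L * g) /\ (forall s : 'I_m, exists g, d s = L * g).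
Proof.
move=> mj uL inv0 inv e; have mn : (m <= n)%N by rewrite (leq_trans mj) 1?ltnW.
(* Index 0 carries the constant 1, paired with [d0]; index s + 1 carries N_s, paired with [d s]. *)
pose p (i : 'I_m.+1) : {poly P} :=
  if unlift ord0 i is Some s then flag_poly s else 1.
pose d' (i : 'I_m.+1) := uni j (if unlift ord0 i is Some s then d s else d0).
have shift_uni f : (forall c, mpoly_act (transvection j m c) f = f) ->
    forall w, w \in flag_elts m -> uni j f \Po ('X + w%:P) = uni j f.
  move=> invf _ /mapP[c _ ->]; have {2}<- := invf (extend c).
  apply: (uni_shift (h := mpoly_act (transvection j m (extend c)))) => [a|k|].
  - exact: mpoly_actC.
  - exact: mpoly_act_transvection.
  exact: uni_flag_elt.
have [mN sN] := flag_poly_monic_size m.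
have p_monic (i : 'I_m.+1) : p i \is monic.
  by rewrite /p; case: unliftP => [s|] _; rewrite ?monic1 ?(flag_poly_monic_size s).1.
have p_size (i k : 'I_m.+1) : (i < k)%N -> (size (p i) < size (p k))%N.
  rewrite /p; case: (unliftP ord0 i) => [s|] ->; case: (unliftP ord0 k) => [t|] -> //=.
    rewrite /bump !add1n ltnS => st.
    by rewrite !(flag_poly_monic_size _).2 ltnS ltn_exp2l.
  by move=> _; rewrite (flag_poly_monic_size _).2 size_poly1 ltnS expn_gt0 q_gt0.
have pW (i : 'I_m.+1) : (size (p i) <= size (flag_elts m))%N.
  rewrite size_flag_elts /p; case: unliftP => [s|] _.
    by rewrite (flag_poly_monic_size _).2 ltn_exp2l.
  by rewrite size_poly1 expn_gt0 q_gt0.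
have e' : \sum_i d' i * p i = L%:P * uni j h.
  transitivity (uni j (L * h)); last by rewrite rmorphM /= uL.
  rewrite big_ord_recl /d' /p unlift_none.
  rewrite -e rmorphD /=.
  congr (_ + _); first exact: mulr1.
  rewrite rmorph_sum; apply: eq_bigr => s _ /=.
  have sj : (s <= j)%N by apply: leq_trans mj; apply: ltnW.
  rewrite liftK rmorphM /= (uni_flag_poly _ sj).
  by rewrite mvarE uniX eqxx comp_polyXr mulrC.
have dvd := shift_invariant_dvd p_monic p_size (flag_elts_uniq mn) _ pW mN _ _ _ e'.
have {}dvd (i : 'I_m.+1) : exists g : {poly P}, d' i = L%:P * g.
  apply: dvd; rewrite ?size_flag_elts ?expn_gt0 ?q_gt0 //.
    by move=> _ /mapP[c _ ->]; apply: flag_poly_shift.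
  by move=> k w wW; rewrite /d'; apply: shift_uni => //; case: unliftP.
have evalL f (g : {poly P}) : uni j f = L%:P * g -> exists g', f = L * g'.
  move=> ef; exists g.['X_j]; by rewrite -[LHS](uniK j) ef hornerM hornerC.
split=> [|s].
  by have [g] := dvd ord0; rewrite /d' unlift_none => /evalL.
by have [g] := dvd (lift ord0 s); rewrite /d' liftK => /evalL.
Qed.

End LinearizedPolynomials.

(** * Invariant one-forms *)

Section LinearForms.
Variables (R : comNzRingType) (n : nat).
Implicit Types (u v : extalg R n) (j : nat).

Definition ext_linear j u := exists2 c : 'I_n -> R,
  forall i : 'I_n, (j <= i)%N -> c i = 0 & u = \sum_i c i *: ext_var R i.

Lemma ext_linear0 j : ext_linear j 0.
Proof. by exists (fun=> 0) => //; rewrite big1 // => i _; rewrite scale0r. Qed.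

Lemma ext_linearD j u v : ext_linear j u -> ext_linear j v -> ext_linear j (u + v).
Proof.
move=> [c c0 ->] [d d0 ->]; exists (fun i => c i + d i) => [i ij|].
  by rewrite c0 ?d0 ?addr0.
by rewrite -big_split; apply: eq_bigr => i _; rewrite scalerDl.
Qed.

Lemma ext_linearZ j a u : ext_linear j u -> ext_linear j (a *: u).
Proof.
move=> [c c0 ->]; exists (fun i => a * c i) => [i ij|].
  by rewrite c0 ?mulr0.
by rewrite scaler_sumr; apply: eq_bigr => i _; rewrite scalerA.
Qed.

Lemma ext_linear_var j (i : 'I_n) : (i < j)%N -> ext_linear j (ext_var R i).
Proof.
move=> ij; exists (fun k => (k == i)%:R) => [k jk|].
  by case: eqP jk => // ->; rewrite leqNgt ij.
rewrite (bigD1 i) //= eqxx scale1r big1 ?addr0 // => k /negPf ->.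
by rewrite scale0r.
Qed.

Lemma ext_linearW j k u : (j <= k)%N -> ext_linear j u -> ext_linear k u.
Proof. by move=> jk [c c0 ->]; exists c => // i /(leq_trans jk); apply: c0. Qed.

Lemma ext_linear_sum (J : Type) (r : seq J) (Q : pred J) j (u : J -> extalg R n) :
  (forall l, Q l -> ext_linear j (u l)) -> ext_linear j (\sum_(l <- r | Q l) u l).
Proof.
move=> hu; elim/big_rec: _ => [|l v Ql hv]; first exact: ext_linear0.
exact/ext_linearD/hv/hu.
Qed.

Lemma ext_below_linM j u b :
  ext_linear j u -> ext_below j b -> ext_below j (u * b).
Proof.
move=> [c c0 ->] hb; rewrite mulr_suml; apply: ext_below_sum => i _.
rewrite -scalerAl; have [ji|ij] := leqP j i; last exact/ext_belowZ/ext_below_varM.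
by rewrite c0 // scale0r => S _; rewrite ffunE.
Qed.

End LinearForms.

Section InvariantForms.
Variables (F : finFieldType) (n : nat).
Local Notation P := {mpoly F[n]}.
Local Notation A := (polyext F n).
Implicit Types (i k s t : nat) (c : nat -> F) (j : 'I_n).

Definition evar k : A := if insub k is Some i then ext_var P (i : 'I_n) else 0.

Lemma evarE j : evar j = ext_var P j. Proof. by rewrite /evar valK. Qed.

Definition flag_form m c : A := \sum_(i < m) (c i)%:MP *: evar i.

(* Over the fraction field there are one-forms [theta_s] such that           *)
(* [y_i = \sum_(s <= i) (flag_poly s).[x_i] *: theta_s] for all i; they do not *)
(* depend on k, and [flag_cofactor k s] is [flag_disc k *: theta_s].         *)
Fixpoint flag_cofactor k s : A :=
  if k is k'.+1 then
    if s == k' then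
      flag_disc F n k' *: evar k'
        - \sum_(t < k') (flag_poly F n t).[mvar F n k'] *: flag_cofactor k' t
    else (flag_poly F n k').[mvar F n k'] *: flag_cofactor k' s
  else 0.

Local Notation N s i := ((flag_poly F n s).[mvar F n i]).
Local Notation disc := (flag_disc F n).

Definition flag_residue k i : A :=
  disc k *: evar i - \sum_(t < k) N t i *: flag_cofactor k t.

Lemma flag_discS k : disc k.+1 = disc k * N k k.
Proof. by rewrite /flag_disc big_ord_recr. Qed.

Lemma flag_cofactorS k s : (s < k)%N ->
  flag_cofactor k.+1 s = N k k *: flag_cofactor k s.
Proof. by rewrite /= => sk; rewrite ltn_eqF. Qed.

Lemma flag_cofactorSn k : flag_cofactor k.+1 k = flag_residue k k.
Proof. by rewrite /= eqxx. Qed.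

(** This is the system defining the theta_t with denominators cleared; the terms with t > i vanish
    because x_i is a root of N_t. *)
Lemma flag_residue_eq0 k i : (i < k)%N -> flag_residue k i = 0.
Proof.
suff e : (i < k)%N -> disc k *: evar i = \sum_(t < k) N t i *: flag_cofactor k t.
  by move=> /e; rewrite /flag_residue => ->; apply: subrr.
elim: k => // k IHk.
rewrite ltnS leq_eqVlt big_ord_recr flag_cofactorSn flag_discS.
under eq_bigr => t _ do
  rewrite (flag_cofactorS (ltn_ord t)) scalerA mulrC -scalerA.
rewrite -scaler_sumr mulrC -scalerA /= => /orP[/eqP ->|ik].
  by rewrite /flag_residue -scalerDr addrC subrK.
by rewrite (flag_poly_mvar_lt _ _ ik) scale0r addr0 (IHk ik).
Qed.

(** By additivity of the N_t the system for the y_i extends to linear combinations. The right-hand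
    side is what the sum in [flag_residue k j] gains when this linear form is added to x_j. *)
Lemma flag_residue_form k m c : (m <= k)%N ->
  disc k *: flag_form m c =
    \sum_(t < k) (flag_poly F n t).[flag_elt n m c] *: flag_cofactor k t.
Proof.
move=> mk; under eq_bigr => t _ do rewrite flag_poly_horner_sum scaler_suml.
rewrite exchange_big scaler_sumr; apply: eq_bigr => i _ /=.
have /eqP := flag_residue_eq0 (leq_trans (ltn_ord i) mk).
rewrite subr_eq0 scalerA mulrC -scalerA => /eqP ->.
rewrite scaler_sumr; apply: eq_bigr => t _.
by rewrite scalerA mul_mpolyC.
Qed.

Lemma flag_residue_linear k i : (k <= i)%N ->
  (forall s, (s < k)%N -> ext_linear s.+1 (flag_cofactor k s)) ->
  ext_linear i.+1 (flag_residue k i).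
Proof.
move=> ki IH; rewrite /flag_residue -scaleN1r; apply: ext_linearD.
  apply: ext_linearZ; rewrite /evar; case: insubP => [l _ <-|_].
    exact: ext_linear_var.
  exact: ext_linear0.
apply: ext_linearZ; apply: ext_linear_sum => t _; apply: ext_linearZ.
apply: ext_linearW (IH t (ltn_ord t)).
by rewrite ltnS (leq_trans (ltnW (ltn_ord t))).
Qed.

Lemma flag_cofactor_linear k s : (s < k)%N -> ext_linear s.+1 (flag_cofactor k s).
Proof.
elim: k s => // k IHk s; rewrite ltnS leq_eqVlt => /orP[/eqP->|sk].
  by rewrite flag_cofactorSn; apply: flag_residue_linear.
by rewrite flag_cofactorS //; apply/ext_linearZ/IHk.
Qed.

(** The form zeta_i for a block starting at [m], multiplied by [flag_disc m]; for i < m it comes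
    from theta_i. *)
Definition flag_frame m i : A :=
  if (i < m)%N then flag_cofactor m i else flag_residue m i.

Lemma flag_frame_linear m i : ext_linear i.+1 (flag_frame m i).
Proof.
rewrite /flag_frame; case: ltnP => im; first exact: flag_cofactor_linear.
by apply: flag_residue_linear => // s; apply: flag_cofactor_linear.
Qed.

(* For the group U_I, [m k] is the first position of the block of k. *)
Definition adapted (m : 'I_n -> nat) (g : 'M[F]_n) :=
  forall i k : 'I_n, (m k <= i)%N -> g i k = (i == k)%:R.

Section Action.
Variables (m : 'I_n -> nat) (g : 'M[F]_n).
Hypothesis m_le : forall j, (m j <= j)%N.
Hypothesis g_adapted : adapted m g.

Lemma adapted_act j : exists c,
  mpoly_act g 'X_j = 'X_j + flag_elt n (m j) c /\
  polyext_act g (ext_var P j) = ext_var P j + flag_form (m j) c.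
Proof.
pose c i := if insub i is Some i' then g (i' : 'I_n) j else 0.
have mn : (m j <= n)%N by rewrite (leq_trans (m_le j)) // ltnW.
have gE (i : 'I_n) : g i j = (i == j)%:R + (i < m j)%N%:R * c i.
  have [lt_im|le_mi] := ltnP i (m j); last by rewrite g_adapted // mul0r addr0.
  have -> : (i == j) = false.
    by apply/eqP=> e; move: lt_im; rewrite e ltnNge m_le.
  by rewrite mul1r add0r /c valK.
exists c; split.
  rewrite mpoly_actX; under eq_bigr => i _ do rewrite gE scalerDl.
  rewrite big_split /= (sum_flag_elt _ mn) (bigD1 j) //= eqxx scale1r big1 ?addr0 //.
  by move=> i /negPf ->; rewrite scale0r.
rewrite polyext_act_var /var_act.
under eq_bigr => i _ do rewrite gE mpolyCD scalerDl.
rewrite big_split /=; congr (_ + _).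
  rewrite (bigD1 j) //= eqxx scale1r big1 ?addr0 // => i /negPf ->.
  by rewrite mpolyC0 scale0r.
rewrite /flag_form.
rewrite (big_ord_widen n (fun i => (c i)%:MP *: evar i) mn).
rewrite [RHS]big_mkcond; apply: eq_bigr => i _; rewrite evarE.
by case: ifP => _; rewrite ?mul1r // mul0r mpolyC0 scale0r.
Qed.

Lemma flag_poly_adapted i f : (i <= n)%N ->
  mpoly_act g (flag_poly F n i).[f] = (flag_poly F n i).[mpoly_act g f].
Proof.
apply: (flag_poly_act (h := mpoly_act g)) => k kn.
have [c [gX _]] := adapted_act (Ordinal kn).
exists (m (Ordinal kn)), c; split; first exact: (m_le (Ordinal kn)).
by rewrite (mvarE F (Ordinal kn)).
Qed.

Lemma flag_disc_adapted k : (k <= n)%N -> mpoly_act g (disc k) = disc k.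
Proof.
move=> kn; rewrite /flag_disc rmorph_prod; apply: eq_bigr => i _ /=.
have lt_in := leq_trans (ltn_ord i) kn.
rewrite (flag_poly_adapted _ (ltnW lt_in)) (mvarE F (Ordinal lt_in)).
have [c [-> _]] := adapted_act (Ordinal lt_in).
by rewrite flag_poly_hornerD (flag_poly_flag_elt _ _ (m_le (Ordinal lt_in))) addr0.
Qed.

(** The changes of y_j and of the sum over the N_t(x_j) cancel by [flag_residue_form]. *)
Lemma flag_residue_adapted k j : (k <= n)%N -> (m j <= k)%N ->
  (forall s, (s < k)%N -> polyext_act g (flag_cofactor k s) = flag_cofactor k s) ->
  polyext_act g (flag_residue k j) = flag_residue k j.
Proof.
move=> kn mk IH; rewrite /flag_residue raddfB /= polyext_actZ.
rewrite [polyext_act g (\sum_(t < k) _)]raddf_sum /=.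
rewrite (flag_disc_adapted kn) evarE; have [c [gX ->]] := adapted_act j.
have -> : \sum_(t < k) polyext_act g (N t j *: flag_cofactor k t) =
    \sum_(t < k) N t j *: flag_cofactor k t +
    \sum_(t < k) (flag_poly F n t).[flag_elt n (m j) c] *: flag_cofactor k t.
  rewrite -big_split; apply: eq_bigr => t _ /=.
  have tn := leq_trans (ltnW (ltn_ord t)) kn.
  rewrite polyext_actZ (flag_poly_adapted _ tn) (IH _ (ltn_ord t)).
  by rewrite mvarE gX flag_poly_hornerD scalerDl.
rewrite scalerDr (flag_residue_form _ mk).
by rewrite opprD addrACA subrr addr0.
Qed.

Lemma flag_cofactor_adapted k s : (k <= n)%N -> (s < k)%N ->
  polyext_act g (flag_cofactor k s) = flag_cofactor k s.
Proof.
elim: k s => // k IHk s kn; rewrite ltnS leq_eqVlt => /orP[/eqP->|sk].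
  rewrite flag_cofactorSn; apply: (flag_residue_adapted (j := Ordinal kn)).
  - exact: ltnW.
  - exact: (m_le (Ordinal kn)).
  by move=> t; apply/IHk/ltnW.
rewrite (flag_cofactorS sk) polyext_actZ (IHk _ (ltnW kn) sk).
(* N_k(x_k) is fixed because [flag_disc k.+1] and its nonzero factor [flag_disc k] are. *)
have := flag_disc_adapted kn; rewrite flag_discS rmorphM /=.
rewrite (flag_disc_adapted (ltnW kn)) => /(mulfI (flag_disc_neq0 F (ltnW kn))).
by move=> ->.
Qed.

Lemma flag_frame_adapted k j : (k <= n)%N -> (m j <= k)%N ->
  polyext_act g (flag_frame k j) = flag_frame k j.
Proof.
move=> kn mk; rewrite /flag_frame; case: ifP => jk; first exact: flag_cofactor_adapted.
by apply: flag_residue_adapted => // s; apply: flag_cofactor_adapted.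
Qed.

End Action.

End InvariantForms.

(** * The frame zeta over the fraction field *)

Section FlagLattice.
Variables (F : finFieldType) (n m : nat).
Hypothesis mn : (m <= n)%N.
Local Notation P := {mpoly F[n]}.
Local Notation A := (polyext F n).
Local Notation K := {fraction P}.
Local Notation "p %:F" := (tofrac p).
Local Notation emb := frac_ext.
Local Notation N s i := ((flag_poly F n s).[mvar F n i]).
Local Notation disc := (flag_disc F n).
Implicit Types (i k s : 'I_n) (T : {set 'I_n}) (a : A).

(** Transition matrix from the zeta_s to the y_k: lower triangular, with determinant
    [flag_disc m]. *)
Definition flag_matrix k s : P := if (s < m)%N then N s k else (k == s)%:R.

Definition flag_zeta i : extalg K n := (disc m)%:F^-1 *: emb (flag_frame F n m i).

Lemma flag_frame_var k :
  disc m *: ext_var P k = \sum_s flag_matrix k s *: flag_frame F n m s.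
Proof.
rewrite (bigID (fun s : 'I_n => (s < m)%N)) /=.
have -> : \sum_(s < n | (s < m)%N) flag_matrix k s *: flag_frame F n m s =
    \sum_(t < m) N t k *: flag_cofactor F n m t.
  rewrite (big_ord_widen n (fun t => N t k *: flag_cofactor F n m t) mn).
  by apply: eq_bigr => s sm; rewrite /flag_matrix /flag_frame sm.
have -> : \sum_(s < n | ~~ (s < m)%N) flag_matrix k s *: flag_frame F n m s =
    flag_residue F n m k.
  have [km|mk] := ltnP k m.
    rewrite flag_residue_eq0 //; apply: big1 => s /negPf sm.
    rewrite /flag_matrix sm; case: eqP => [e|_]; last exact: scale0r.
    by rewrite -e km in sm.
  rewrite (bigD1 k) /=; last by rewrite -leqNgt.
  rewrite big1 => [|s /andP[/negPf sm ne]].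
    by rewrite addr0 /flag_matrix /flag_frame ltnNge mk eqxx scale1r.
  by rewrite /flag_matrix sm eq_sym (negPf ne) scale0r.
by rewrite /flag_residue evarE addrC subrK.
Qed.

Lemma flag_disc_tofrac_neq0 : (disc m)%:F != 0.
Proof. by rewrite tofrac_eq0; apply: flag_disc_neq0. Qed.

Lemma flag_zetaE i : (disc m)%:F *: flag_zeta i = emb (flag_frame F n m i).
Proof. by rewrite /flag_zeta scalerA mulfV ?flag_disc_tofrac_neq0 // scale1r. Qed.

Lemma flag_zeta_linear i : ext_linear i.+1 (flag_zeta i).
Proof.
apply: ext_linearZ; have [c c0 ->] := flag_frame_linear F n m i.
exists (fun k => (c k)%:F) => [k ik|]; first by rewrite (c0 k ik) tofrac0.
rewrite frac_ext_sum; apply: eq_bigr => k _.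
by rewrite frac_extZ frac_ext_var.
Qed.

Let zeta_lin i : exists c : 'I_n -> K, flag_zeta i = \sum_k c k *: ext_var K k.
Proof. by have [c _ e] := flag_zeta_linear i; exists c. Qed.

Let varE k : ext_var K k = \sum_s (flag_matrix k s)%:F *: flag_zeta s.
Proof.
apply: (scalerI flag_disc_tofrac_neq0).
rewrite -frac_ext_var -frac_extZ flag_frame_var.
rewrite frac_ext_sum scaler_sumr; apply: eq_bigr => s _.
by rewrite frac_extZ scalerA mulrC -scalerA flag_zetaE.
Qed.

Let matrix_trig k s : (k < s)%N -> flag_matrix k s = 0.
Proof.
move=> ks; rewrite /flag_matrix; case: ifP => _; first exact: flag_poly_mvar_lt.
by case: eqP ks => // ->; rewrite ltnn.
Qed.

Let matrix_diag k : flag_matrix k k != 0.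
Proof.
rewrite /flag_matrix eqxx; case: ifP => _; first exact: flag_poly_mvar_neq0.
exact: oner_neq0.
Qed.

Let prod_diag (i : nat) : (i <= m)%N ->
  \prod_(k < n | (k < i)%N) flag_matrix k k = disc i.
Proof.
move=> im; rewrite /flag_disc (big_ord_widen n (fun t => N t t) (leq_trans im mn)).
by apply: eq_bigr => k ki; rewrite /flag_matrix (leq_trans ki im).
Qed.

Let prod_matrix : \prod_k flag_matrix k k = disc m.
Proof.
rewrite -(prod_diag (leqnn m)) [RHS]big_mkcond; apply: eq_bigr => k _.
by rewrite /flag_matrix eqxx; case: ifP.
Qed.

Let matrix_coprime i (f g : P) :
  \prod_(k < n | (k < i)%N) flag_matrix k k * f = flag_matrix i i * g ->
  exists h, f = flag_matrix i i * h.
Proof.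
have [im|mi] := ltnP i m.
  rewrite (prod_diag (ltnW im)) /flag_matrix im; exact: flag_disc_coprime.
by rewrite /flag_matrix ltnNge mi /= eqxx => _; exists f; rewrite mul1r.
Qed.

Lemma flag_zeta_independent (c : {set 'I_n} -> K) T :
  \sum_U c U *: \prod_(i in U) flag_zeta i = 0 -> c T = 0.
Proof. exact: (frame_independent zeta_lin varE matrix_trig matrix_diag). Qed.

Lemma flag_zeta_integral i T :
  int_ext ((disc m)%:F *: (flag_zeta i * \prod_(k in T) flag_zeta k)).
Proof.
have := frame_integralM zeta_lin varE matrix_trig matrix_diag [set i] T.
by rewrite prod_matrix big_set1.
Qed.

Lemma flag_zeta_decomposition (j : nat) a : ext_below j a ->
  (forall s, int_ext (flag_zeta s * emb a)) ->
  exists2 c : {set 'I_n} -> P,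
    forall T, ~~ (T \subset [set i : 'I_n | (i < j)%N]) -> c T = 0
    & emb a = (disc m)%:F *: \sum_T (c T)%:F *: \prod_(i in T) flag_zeta i.
Proof.
move=> ja ha; have := frame_decomposition zeta_lin varE matrix_trig matrix_diag
  matrix_coprime ja ha.
by rewrite prod_matrix.
Qed.

Lemma flag_zeta_contract i : (m <= i)%N -> ext_contract i (flag_zeta i) = 1.
Proof.
move=> mi; apply: (scalerI flag_disc_tofrac_neq0).
rewrite -ext_contractZ flag_zetaE -frac_ext_contract /flag_frame ltnNge mi /=.
rewrite /flag_residue [ext_contract i (_ - _)]raddfB /=.
rewrite [ext_contract i (disc m *: _)]linearZ /= evarE ext_contract_var eqxx scale1r.
rewrite [ext_contract i (\sum_(t < m) _)]raddf_sum /= big1 ?subr0 => [|t _].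
  by rewrite frac_extZ frac_ext1.
rewrite linearZ /=; have [c c0 ->] := flag_cofactor_linear F n (ltn_ord t).
rewrite raddf_sum /= big1 ?scaler0 // => k _; rewrite linearZ /= ext_contract_var.
case: eqP => [<-|_]; last by rewrite scale0r scaler0.
by rewrite c0 ?scale0r // (leq_trans _ mi).
Qed.

End FlagLattice.

(** * Splitting invariant forms *)

Section TransvectionAction.
Variables (F : finFieldType) (n : nat).
Local Notation P := {mpoly F[n]}.
Local Notation A := (polyext F n).
Implicit Types (j k : 'I_n) (g : 'M[F]_n) (a b : A).

Lemma polyext_actD g a b : polyext_act g (a + b) = polyext_act g a + polyext_act g b.
Proof. exact: raddfD. Qed.

Lemma polyext_actB g a b : polyext_act g (a - b) = polyext_act g a - polyext_act g b.
Proof. exact: raddfB. Qed.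

Lemma polyext_actM g a b : polyext_act g (a * b) = polyext_act g a * polyext_act g b.
Proof. exact: rmorphM. Qed.

Lemma transvection_other j m (c : nat -> F) (i k : 'I_n) : k != j ->
  transvection j m c i k = (i == k)%:R.
Proof. by move=> /negPf kj; rewrite mxE kj mul0r addr0. Qed.

Lemma transvection_row j m (c : nat -> F) (i k : 'I_n) : (m <= i)%N ->
  transvection j m c i k = (i == k)%:R.
Proof. by move=> mi; rewrite mxE ltnNge mi andbF mul0r addr0. Qed.

(** A transvection at [j] fixes y_k for k < j, so invariance of such a form is invariance of its
    coefficients. *)
Lemma polyext_act_transvection_below j m (c : nat -> F) b : ext_below j b ->
  polyext_act (transvection j m c) b = map_ext (mpoly_act (transvection j m c)) b.
Proof.
move=> jb; rewrite [RHS]ext_decomp; apply: eq_bigr => T _; rewrite map_extE.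
have [Tj|/jb ->] := boolP (T \subset [set i : 'I_n | (i < j)%N]); last first.
  by rewrite !(rmorph0, scale0r).
congr (_ *: _); rewrite ext_basis_prod; apply: eq_bigr => k kT.
have kj : k != j.
  by apply/eqP=> e; move/subsetP/(_ k kT): Tj; rewrite inE e ltnn.
rewrite /var_act (bigD1 k) //= big1 => [|i ne]; rewrite transvection_other //.
  by rewrite eqxx mpolyC1 scale1r addr0.
by rewrite (negPf ne) mpolyC0 scale0r.
Qed.

Lemma polyext_act_sum g (J : Type) (s : seq J) (Q : pred J) (u : J -> A) :
  polyext_act g (\sum_(l <- s | Q l) u l) = \sum_(l <- s | Q l) polyext_act g (u l).
Proof. exact: raddf_sum. Qed.

Lemma ext_contract_act j g a : (forall k, g j k = (j == k)%:R) ->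
  ext_contract j (polyext_act g a) = polyext_act g (ext_contract j a).
Proof.
move=> gj; apply: (@ext_contract_morph _ _ (mpoly_act g) (polyext_act g) j
  (fun k i => (g i k)%:MP)) => [b c|c b|b c||| k| k].
- exact: polyext_actD.
- exact: polyext_actZ.
- exact: polyext_actM.
- exact: raddf0.
- exact: rmorph1.
- exact: polyext_act_var.
by rewrite gj; case: eqP; rewrite ?mpolyC1 ?mpolyC0.
Qed.

End TransvectionAction.

Section Main.
Variables (F : finFieldType) (n : nat) (m : 'I_n -> nat).
Hypothesis m_le : forall j : 'I_n, (m j <= j)%N.
Hypothesis m_mono : forall i j : 'I_n, (i <= j)%N -> (m i <= m j)%N.
Local Notation P := {mpoly F[n]}.
Local Notation A := (polyext F n).
Local Notation "p %:F" := (tofrac p).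
Local Notation emb := frac_ext.
Local Notation N s i := ((flag_poly F n s).[mvar F n i]).
Local Notation disc := (flag_disc F n).
Local Notation zeta j i := (flag_zeta F (m j) i).
Implicit Types (i j k : 'I_n) (S T : {set 'I_n}) (a b : A) (g : 'M[F]_n).

Let m_len j : (m j <= n)%N.
Proof. by rewrite (leq_trans (m_le j)) // ltnW. Qed.

Lemma adapted_transvection j (c : nat -> F) : adapted m (transvection j (m j) c).
Proof.
move=> i k; have [->|kj _] := eqVneq k j; last exact: transvection_other.
exact: transvection_row.
Qed.

(** Restricted to j < l because these matrices have the identity row at l - 1, as m j <= j <= l - 1;
    contraction with y_(l-1) therefore preserves the condition. *)
Definition transvection_fixed (l : nat) a := forall j (c : nat -> F),
  (j < l)%N -> polyext_act (transvection j (m j) c) a = a.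

(* Splitting off the [y_j]-part: the coefficient of [y_j] in an invariant form *)
(* lies in the span of the frame because the shifts of 'X_j force the          *)
(* denominators of the two parts to cancel separately.                         *)
Lemma transvection_fixed_peel j a : ext_below j.+1 a -> transvection_fixed j.+1 a ->
  exists (c : {set 'I_n} -> P) (a0 : A),
  [/\ forall T, ~~ (T \subset [set i : 'I_n | (i < j)%N]) -> c T = 0,
      ext_below j a0, transvection_fixed j a0 &
      emb a = (disc (m j))%:F *: \sum_T (c T)%:F *:
                (zeta j j * \prod_(i in T) zeta j i) + emb a0].
Proof.
move=> ja fa; set M := m j; set a1 := ext_contract j a.
pose L := disc M.
have MM : (M <= j)%N := m_le j.
have L0 : L != 0 := flag_disc_neq0 F (m_len j).
pose eta := flag_residue F n M j.
have frameE : flag_frame F n M j = eta by rewrite /flag_frame ltnNge MM.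
have j1 : ext_below j a1 by apply: ext_below_contract.
have fa1 : transvection_fixed j.+1 a1.
  move=> i c ij; rewrite -ext_contract_act ?fa // => k.
  by apply: transvection_row; rewrite (leq_trans (m_le i)).
have feta : forall i c, polyext_act (transvection i (m i) c) eta = eta.
  move=> i c; rewrite -frameE.
  exact: (flag_frame_adapted m_le (adapted_transvection i c) (m_len j) (leqnn _)).
(* [R] is L times a - zeta_j a1; its divisibility by L is the first goal. *)
have [R RD] : exists R : A, R = L *: a - eta * a1 := ex_intro _ _ erefl.
have fR : transvection_fixed j.+1 R.
  move=> i c ij; rewrite RD polyext_actB polyext_actZ polyext_actM feta.
  rewrite (fa _ _ ij) (fa1 _ _ ij).
  by rewrite (flag_disc_adapted m_le (adapted_transvection i c) (m_len j)).
have [d dE] : exists d : A, d = a - ext_var P j * a1 := ex_intro _ _ erefl.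
have RE : R = L *: d +
    \sum_(s < M) N s j *: (flag_cofactor F n M s * a1).
  have -> : \sum_(s < M) N s j *: (flag_cofactor F n M s * a1) =
      (\sum_(s < M) N s j *: flag_cofactor F n M s) * a1.
    by rewrite mulr_suml; apply: eq_bigr => s _; rewrite scalerAl.
  rewrite dE RD /eta /flag_residue evarE mulrBl opprB scalerBr scalerAl.
  by rewrite -[RHS]addrA [X in _ = _ + X]addrC.
have jcof (s : 'I_M) : ext_below j (flag_cofactor F n M s * a1).
  apply: ext_below_linM j1; apply: ext_linearW (flag_cofactor_linear F n (ltn_ord s)).
  exact: leq_trans MM.
have jR : ext_below j R.
  rewrite RE; apply: ext_belowD; first by rewrite dE; exact/ext_belowZ/ext_below_split.
  by apply: ext_below_sum => s _; apply/ext_belowZ/jcof.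
have coef_inv b : ext_below j b -> transvection_fixed j.+1 b ->
    forall S c, mpoly_act (transvection j M c) (b S) = b S.
  move=> jb fb S c; rewrite -map_extE -polyext_act_transvection_below //.
  by rewrite fb.
have fcof (s : 'I_M) : transvection_fixed j.+1 (flag_cofactor F n M s * a1).
  move=> i c ij; rewrite polyext_actM (fa1 _ _ ij).
  by rewrite (flag_cofactor_adapted m_le (adapted_transvection i c) (m_len j)).
(* Solving [RE] for [L *: d] leaves [R] and the forms [- flag_cofactor s * a1], all with
   shift-invariant coefficients, so [L] divides each of them. *)
have dvd S : (exists h, R S = L * h) /\
    forall s : 'I_M, exists h, - (flag_cofactor F n M s * a1) S = L * h.
  apply: (@transvection_invariant_dvd F n j M _
    (fun s : 'I_M => - (flag_cofactor F n M s * a1) S) L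
    (d S)) => //.
  - exact: uni_flag_disc.
  - exact: coef_inv.
  - by move=> c s; rewrite rmorphN /= coef_inv.
  rewrite RE ext_addE ext_scaleE sum_ffunE -addrA -big_split /= big1 ?addr0 //.
  by move=> s _; rewrite ext_scaleE mulrN subrr.
have /fin_all_exists[r0 r0E] S := (dvd S).1.
pose a0 : A := [ffun S : {set _} => r0 S].
have a0E : R = L *: a0 by apply/ffunP=> S; rewrite ext_scaleE ffunE r0E.
have cofE (s : 'I_M) : exists b, flag_cofactor F n M s * a1 = L *: b.
  have /fin_all_exists[b bE] S := (dvd S).2 s.
  exists [ffun S : {set _} => - b S]; apply/ffunP=> S.
  by rewrite ext_scaleE [X in _ = _ * X]ffunE mulrN -bE opprK.
have LF0 := flag_disc_tofrac_neq0 F (m_len j).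
have int_zeta i : int_ext (zeta j i * emb a1).
  suff [b bE] : exists b, flag_frame F n M i * a1 = L *: b.
    exists b; apply: (scalerI LF0).
    by rewrite scalerAl flag_zetaE // -frac_extM bE frac_extZ.
  rewrite /flag_frame; case: ltnP => iM; first exact: (cofE (Ordinal iM)).
  (* For i >= M one has zeta_i = y_i - \sum_s N_s(x_i) theta_s, and the theta_s a1 are already known
     to be polynomial. *)
  have /fin_all_exists[b bE] := cofE.
  exists (evar F n i * a1 - \sum_(s < M) N s i *: b s).
  rewrite /flag_residue mulrBl scalerBr scalerAl mulr_suml scaler_sumr.
  congr (_ - _); apply: eq_bigr => s _.
  by rewrite -scalerAl bE !scalerA mulrC.
have [c c0 cE] := flag_zeta_decomposition (m_len j) j1 int_zeta.
exists c, a0; split=> //.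
- move=> S hS; have := jR S hS; rewrite a0E ext_scaleE => /eqP.
  by rewrite mulf_eq0 (negPf L0) => /eqP.
- move=> i c' ij; have := fR i c' (ltnW ij); rewrite a0E polyext_actZ.
  rewrite (flag_disc_adapted m_le (adapted_transvection i c') (m_len j)) => e.
  apply/ffunP=> S; apply: (mulfI L0).
  by have /ffunP/(_ S) := e; rewrite !ext_scaleE.
apply: (scalerI LF0); rewrite -frac_extZ.
have -> : disc (m j) *: a = eta * a1 + L *: a0 by rewrite -a0E RD addrC subrK.
rewrite frac_extD frac_extM -frameE -(flag_zetaE F (m_len j)) frac_extZ scalerDr.
congr (_ + _); rewrite cE.
exact: scalerM_sum.
Qed.

End Main.

(** * A basis of the invariants *)

Lemma ext_scaleI (R : idomainType) (n : nat) (c : R) (a b : extalg R n) :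
  c != 0 -> c *: a = c *: b -> a = b.
Proof.
move=> c0 /ffunP e; apply/ffunP=> S; apply: (mulfI c0).
by rewrite -!ext_scaleE.
Qed.

Lemma frac_ext_below_inj (P : idomainType) (n j : nat) (a : extalg P n) :
  ext_below j (frac_ext a) -> ext_below j a.
Proof. by move=> ja S /ja; rewrite frac_extE => /eqP; rewrite tofrac_eq0 => /eqP. Qed.

Lemma ext_below_prod (R : comNzRingType) (n j : nat) (T : {set 'I_n})
    (u : 'I_n -> extalg R n) :
  (forall i : 'I_n, ext_linear i.+1 (u i)) -> T \subset [set i : 'I_n | (i < j)%N] ->
  ext_below j (\prod_(i in T) u i).
Proof.
move=> hu /subsetP Tj; elim/big_rec: _ => [S hS|i b /Tj].
  by rewrite ffunE; case: eqP => // e; rewrite e sub0set in hS.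
by rewrite inE => ij; apply/ext_below_linM/ext_linearW/hu.
Qed.

Lemma sum_setU1 (n : nat) (V : zmodType) (j : 'I_n) (f : {set 'I_n} -> V) :
  \sum_(S : {set 'I_n} | j \in S) f S =
  \sum_(T : {set 'I_n} | j \notin T) f (j |: T).
Proof.
rewrite (reindex_onto (fun T => j |: T) (fun S => S :\ j)) /=; last first.
  by move=> S jS; apply: setD1K.
apply: eq_bigl => T; rewrite setU11 /=.
apply/eqP/idP => [<-|]; first by rewrite !inE eqxx.
exact: setU1K.
Qed.

Lemma sum_merge_setU1 (n : nat) (R : nzRingType) (V : lmodType R) (j : 'I_n)
    (c d : {set 'I_n} -> R) (w : {set 'I_n} -> V) :
  (forall T : {set 'I_n}, j \in T -> c T = 0) ->
  (forall S : {set 'I_n}, j \in S -> d S = 0) ->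
  \sum_(S : {set 'I_n}) (if j \in S then c (S :\ j) else d S) *: w S =
  \sum_(T : {set 'I_n}) c T *: w (j |: T) + \sum_(S : {set 'I_n}) d S *: w S.
Proof.
move=> c0 d0; rewrite (bigID (fun S : {set 'I_n} => j \in S)) /= sum_setU1.
congr (_ + _).
  rewrite [RHS](bigID (fun T : {set 'I_n} => j \notin T)) /=.
  rewrite [X in _ = _ + X]big1 ?addr0 => [|T]; last first.
    by rewrite negbK => /c0 ->; rewrite scale0r.
  by apply: eq_bigr => T jT; rewrite setU11 setU1K.
rewrite [RHS](bigID (fun S : {set 'I_n} => j \in S)) /= [X in _ = X + _]big1 ?add0r => [|S jS].
  by apply: eq_bigr => S /negPf ->.
by rewrite (d0 _ jS) scale0r.
Qed.

Lemma sum_linear_setU1 (n : nat) (R : nzRingType) (V V' : lmodType R)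
    (phi : {linear V -> V'}) (j : 'I_n) (c : {set 'I_n} -> R) (w : {set 'I_n} -> V) :
  (forall S : {set 'I_n}, j \notin S -> c S *: phi (w S) = 0) ->
  \sum_(S : {set 'I_n}) c S *: w S = 0 ->
  \sum_(T : {set 'I_n}) (if j \in T then 0 else c (j |: T)) *: phi (w (j |: T)) = 0.
Proof.
move=> phi0 /(congr1 phi); rewrite linear0 linear_sum.
rewrite (bigID (fun S : {set 'I_n} => j \in S)) /= [X in _ + X]big1 => [|S jS].
  rewrite addr0 sum_setU1 => {2}<-.
  rewrite (bigID (fun T : {set 'I_n} => j \in T)) /= big1 ?add0r => [|T ->].
    by apply: eq_bigr => T /negPf ->; rewrite linearZ.
  by rewrite scale0r.
by rewrite linearZ; apply: phi0.
Qed.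

Section Basis.
Variables (F : finFieldType) (n : nat) (m : 'I_n -> nat).
Hypothesis m_le : forall j : 'I_n, (m j <= j)%N.
Hypothesis m_mono : forall i j : 'I_n, (i <= j)%N -> (m i <= m j)%N.
Local Notation P := {mpoly F[n]}.
Local Notation A := (polyext F n).
Local Notation "p %:F" := (tofrac p).
Local Notation emb := frac_ext.
Local Notation disc := (flag_disc F n).
Local Notation zeta j i := (flag_zeta F (m j) i).
Local Notation init l := [set i : 'I_n | (i < l)%N].
Implicit Types (i j k : 'I_n) (S T : {set 'I_n}) (a b : A) (g : 'M[F]_n) (l : nat).

Let m_len j : (m j <= n)%N.
Proof. by rewrite (leq_trans (m_le j)) // ltnW. Qed.

(** Integrality is [flag_zeta_integral]. All factors are formed with the block start [m j] of [j],
    not their own; they are still invariant since m i <= m j for i <= j. *)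
Lemma flag_basis_elt j T : T \subset init j -> exists w : A,
  [/\ forall g, adapted m g -> polyext_act g w = w, ext_below j.+1 w
    & emb w = (disc (m j))%:F *: (zeta j j * \prod_(i in T) zeta j i)].
Proof.
move=> Tj; have [w wE] := flag_zeta_integral F (m_len j) j T.
have D0 := flag_disc_neq0 F (m_len j).
exists w; split=> [g ga||]; last by rewrite -wE.
  have [f fD] : exists f : 'I_n -> A, forall i, f i = flag_frame F n (m j) i.
    by exists (flag_frame F n (m j)).
  have fE i : emb (f i) = (disc (m j))%:F *: zeta j i.
    by rewrite fD (flag_zetaE F (m_len j)).
  (* One power of the denominator for each factor turns every zeta into an invariant polynomial
     form; the invariant power is cancelled at the end. *)
  have e : disc (m j) ^+ #|T|.+1 *: w =
      disc (m j) *: (f j * \prod_(i in T) f i).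
    apply: frac_ext_inj; rewrite !frac_extZ -wE frac_extM frac_ext_prod.
    have -> : (disc (m j) ^+ #|T|.+1)%:F = (disc (m j))%:F ^+ #|T|.+1.
      exact: tofracXn.
    rewrite ext_scale_prod.
    congr (_ *: _).
    rewrite (fE j); congr (_ * _).
    by apply: eq_bigr => i _; rewrite (fE i).
  have fg i : i \in j |: T -> polyext_act g (f i) = f i.
    move=> ijT; rewrite fD; apply: (flag_frame_adapted m_le ga (m_len j)); apply: m_mono.
    by move: ijT; rewrite !inE => /orP[/eqP->//|/(subsetP Tj)]; rewrite inE => /ltnW.
  have Dg : mpoly_act g (disc (m j)) = disc (m j).
    exact: (flag_disc_adapted m_le ga (m_len j)).
  apply: (ext_scaleI (c := disc (m j) ^+ #|T|.+1)); first exact: expf_neq0.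
  have : polyext_act g (disc (m j) ^+ #|T|.+1 *: w) = disc (m j) ^+ #|T|.+1 *: w.
    rewrite e polyext_actZ Dg polyext_actM (fg j (setU11 j T)).
    congr (_ *: (_ * _)); rewrite [LHS](rmorph_prod (polyext_act g)).
    by apply: eq_bigr => i iT; apply: fg; rewrite inE iT orbT.
  by rewrite polyext_actZ rmorphXn /= Dg.
apply: frac_ext_below_inj; rewrite -wE; apply/ext_belowZ/ext_below_linM.
  exact: flag_zeta_linear.
apply: ext_below_prod; first exact: flag_zeta_linear.
by apply: subset_trans Tj _; apply/subsetP=> i; rewrite !inE => /ltnW; rewrite ltnS.
Qed.

(** The conditions of the last clause say that [j] is the maximum of [S]. *)
Definition flag_basis_spec S (v : A) :=
  [/\ forall g, adapted m g -> polyext_act g v = v,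
      forall l, S \subset init l -> ext_below l v,
      S = set0 -> v = 1
    & forall j, j \in S -> S \subset init j.+1 ->
        emb v = (disc (m j))%:F *: (zeta j j * \prod_(i in S :\ j) zeta j i)].

Lemma flag_basis : exists w : {set 'I_n} -> A, forall S, flag_basis_spec S (w S).
Proof.
apply: fin_all_exists => S; have [->|/set0Pn[i0 i0S]] := eqVneq S set0.
  exists 1; split=> // [g _|l _ T|j]; first exact: rmorph1.
    by rewrite ffunE; case: eqP => // ->; rewrite sub0set.
  by rewrite inE.
case: (arg_maxnP (fun i : 'I_n => i : nat) i0S) => j jS jmax.
have Sj : S :\ j \subset init j.
  apply/subsetP=> i; rewrite !inE => /andP[ij /jmax ji].
  by rewrite ltn_neqAle ij.
have [w [wg wj wE]] := flag_basis_elt Sj.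
exists w; split=> [|l Sl|e|i iS Si].
- exact: wg.
- apply: (ext_belowW _ wj); move/subsetP/(_ j jS): Sl; by rewrite inE.
- by have : j \in S := jS; rewrite e inE.
have -> : i = j; last exact: wE.
apply/val_inj/anti_leq/andP; split; first exact: jmax.
by move/subsetP/(_ j jS): Si; rewrite inE ltnS.
Qed.

Section Combination.
Variable w : {set 'I_n} -> A.
Hypothesis w_below : forall S l, S \subset init l -> ext_below l (w S).
Hypothesis w0 : w set0 = 1.
Hypothesis wE : forall S j, j \in S -> S \subset init j.+1 ->
  emb (w S) = (disc (m j))%:F *: (zeta j j * \prod_(i in S :\ j) zeta j i).

Let subU1 j T : T \subset init j -> j |: T \subset init j.+1.
Proof.
move=> /subsetP Tj; apply/subsetP=> i; rewrite !inE ltnS leq_eqVlt => /orP[/eqP->|/Tj].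
  by rewrite eqxx.
by rewrite inE => ->; rewrite orbT.
Qed.

Let notin_init j T : T \subset init j -> j \notin T.
Proof. by move=> /subsetP Tj; apply/negP=> /Tj; rewrite inE ltnn. Qed.

Let subD1 j S : j \notin S -> S \subset init j.+1 -> S \subset init j.
Proof.
move=> jS /subsetP Sj; apply/subsetP=> i iS; have := Sj i iS.
rewrite !inE ltnS leq_eqVlt => /orP[/eqP/val_inj e|//].
by rewrite -e iS in jS.
Qed.

(** Each induction step is one use of [transvection_fixed_peel]: the sets containing the last index
    come from the part split off, the others from the remainder. *)
Lemma flag_basis_span l a : (l <= n)%N -> ext_below l a ->
  transvection_fixed m l a -> exists2 c : {set 'I_n} -> P,
    forall S, ~~ (S \subset init l) -> c S = 0 & a = \sum_S c S *: w S.
Proof.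
elim: l a => [|l IHl] a ln la fa.
  exists (fun S => if S == set0 then a set0 else 0) => [S|].
    by case: eqP => // ->; rewrite sub0set.
  rewrite (bigD1 set0) //= eqxx big1 => [|S /negPf ->]; last exact: scale0r.
  by rewrite addr0 w0; apply: ext_below_eq0.
pose j := Ordinal ln.
have [c [a0 [c0 ja0 fa0 aE]]] := transvection_fixed_peel m_le (j := j) la fa.
have [d d0 a0E] := IHl a0 (ltnW ln) ja0 fa0.
exists (fun S => if j \in S then c (S :\ j) else d S) => [S nS|].
  case: ifPn => jS; [apply: c0|apply: d0]; apply: contra nS => Sj.
    by rewrite -(setD1K jS) (subU1 Sj).
  by apply: subset_trans Sj _; apply/subsetP=> i; rewrite !inE => /ltnW; rewrite ltnS.
have cj T : j \in T -> c T = 0.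
  by move=> jT; apply: c0; apply/negP=> /notin_init; rewrite jT.
have dj S : j \in S -> d S = 0.
  by move=> jS; apply: d0; apply/negP=> /(notin_init (j := j)); rewrite jS.
transitivity (\sum_T c T *: w (j |: T) + a0); last first.
  by rewrite {1}a0E; apply/esym/sum_merge_setU1.
apply: frac_ext_inj; rewrite aE frac_extD; congr (_ + _).
rewrite frac_ext_sum scaler_sumr; apply: eq_bigr => T _.
rewrite frac_extZ; have [Tj|/c0 ->] := boolP (T \subset init j); last first.
  by rewrite tofrac0 !scale0r scaler0.
rewrite (wE (setU11 j T) (subU1 Tj)) (setU1K (notin_init Tj)).
by rewrite scalerA mulrC -scalerA.
Qed.

(** With j the last index allowed, contraction with y_j kills the [w S] without j and sends the
    others to [flag_disc] times zeta_(S minus j). These are independent over the fraction field, so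
    the coefficients of sets containing j vanish, and induction handles the rest. *)
Lemma flag_basis_independent l (c : {set 'I_n} -> P) : (l <= n)%N ->
  (forall S, ~~ (S \subset init l) -> c S = 0) ->
  \sum_S c S *: w S = 0 -> forall S, c S = 0.
Proof.
elim: l => [|l IHl] ln c0 e S.
  have [S0|nS] := eqVneq S set0; last first.
    by apply: c0; apply: contra nS => /subsetP S0; apply/eqP/setP=> i; rewrite inE;
       apply/negP=> /S0; rewrite inE.
  have := congr1 (fun a : A => a set0) e.
  rewrite (bigD1 set0) //= big1 ?addr0 => [|T nT].
    by rewrite w0 ext_scaleE !ffunE eqxx mulr1 S0.
  rewrite c0 ?scale0r //; apply: contra nT => /subsetP T0; apply/eqP/setP=> i.
  by rewrite inE; apply/negP=> /T0; rewrite inE.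
pose j := Ordinal ln.
suff cj T : j \in T -> c T = 0.
  apply: (IHl (ltnW ln)) => // T nT; have [/cj //|jT] := boolP (j \in T).
  by apply: c0; apply: contra nT; apply: (subD1 jT).
move=> jT; pose d (U : {set 'I_n}) := (if j \in U then 0 else c (j |: U)) * disc (m j).
have contract_w (U : {set _}) : j \in U -> U \subset init j.+1 ->
    emb (ext_contract j (w U)) =
      (disc (m j))%:F *: \prod_(i in U :\ j) zeta j i.
  move=> jU Uj; rewrite frac_ext_contract (wE jU Uj) ext_contractZ.
  have [u _ uE] := flag_zeta_linear F (m j) j.
  rewrite uE ext_contract_linM -uE (flag_zeta_contract F (m_len j) (m_le j)) mul1r.
  have Zj : ext_below j (\prod_(i in U :\ j) zeta j i).
    apply: ext_below_prod; first exact: flag_zeta_linear.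
    by apply: subD1; rewrite ?inE ?eqxx // (subset_trans (subsetDl _ _)).
  by rewrite (ext_contract_below (leqnn j) Zj) mulr0 subr0.
have e' := sum_linear_setU1 (phi := ext_contract j) (j := j) _ e.
have /(congr1 (fun a : A => emb a)) :
    \sum_(U : {set 'I_n})
      (if j \in U then 0 else c (j |: U)) *: ext_contract j (w (j |: U)) = 0.
  apply: e' => U jU; have [Uj|/c0 ->] := boolP (U \subset init j.+1); last first.
    exact: scale0r.
  have wj : ext_below j (w U) by apply/w_below/(subD1 jU).
  by rewrite /= (ext_contract_below (leqnn j) wj) scaler0.
rewrite frac_ext0 frac_ext_sum => e2.
have : \sum_U (d U)%:F *: \prod_(i in U) zeta j i = 0.
  rewrite -[RHS]e2; apply: eq_bigr => U _; rewrite /d frac_extZ.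
  case: ifPn => jU; first by rewrite mul0r tofrac0 !scale0r.
  have [Uj|/c0 ->] := boolP (j |: U \subset init j.+1); last first.
    by rewrite mul0r tofrac0 !scale0r.
  rewrite (contract_w _ (setU11 j U) Uj) (setU1K jU) scalerA.
  by congr (_ *: _); apply: tofracM.
move/(flag_zeta_independent (m_len j)) => /(_ (T :\ j)).
rewrite /d !inE eqxx /= (setD1K jT) => /eqP.
rewrite tofrac_eq0 mulf_eq0 (negPf (flag_disc_neq0 F (m_len j))) orbF.
by move/eqP.
Qed.

End Combination.

End Basis.

(** * From the basis to freeness over the invariant polynomials *)

Lemma card_set_ord (n : nat) : #|{set 'I_n}| = (2 ^ n)%N.
Proof.
transitivity #|powerset [set: 'I_n]|; last by rewrite card_powerset cardsT card_ord.
by apply: eq_card => S; rewrite powersetE subsetT.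
Qed.

Lemma sum_scalerB_eq0 (R : nzRingType) (V : lmodType R) (J : finType)
    (c d : J -> R) (w : J -> V) :
  \sum_l c l *: w l = \sum_l d l *: w l -> \sum_l (c l - d l) *: w l = 0.
Proof.
by move=> e; under eq_bigr => l _ do rewrite scalerBl; rewrite sumrB e subrr.
Qed.

Lemma free_of_rank_family (R : nzRingType) (M : lmodType R) (k : nat)
    (J : finType) (e : J -> M) : #|J| = k ->
  (forall x : M, exists c : J -> R, x = \sum_l c l *: e l) ->
  (forall c : J -> R, \sum_l c l *: e l = 0 -> forall l, c l = 0) ->
  free_of_rank M k.
Proof.
move=> Jk; case: k / Jk => e_span e_free.
exists (fun i => e (enum_val i)) => x; have [c ->] := e_span x.
have sumE (d : {ffun 'I_#|J| -> R}) :
    \sum_i d i *: e (enum_val i) = \sum_l d (enum_rank l) *: e l.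
  rewrite (reindex_onto enum_rank enum_val) /=; last by move=> i _; apply: enum_valK.
  by apply: eq_big => l; rewrite enum_rankK ?eqxx.
exists [ffun i => c (enum_val i)]; split=> [|d dE].
  by rewrite sumE; apply: eq_bigr => l _; rewrite ffunE enum_rankK.
apply/ffunP=> i; rewrite ffunE; apply/eqP; rewrite -subr_eq0; apply/eqP.
rewrite -[i in d i]enum_valK.
apply: (e_free (fun l => c l - d (enum_rank l))).
by apply: sum_scalerB_eq0; rewrite dE sumE.
Qed.

Section FreeInvariants.
Variables (F : finFieldType) (n : nat) (m : 'I_n -> nat) (G : {set 'M[F]_n}).
Hypothesis m_le : forall j : 'I_n, (m j <= j)%N.
Hypothesis m_mono : forall i j : 'I_n, (i <= j)%N -> (m i <= m j)%N.
Hypothesis G_adapted : forall g, g \in G -> adapted m g.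
Hypothesis G_transvection : forall (j : 'I_n) (c : nat -> F),
  transvection j (m j) c \in G.
Local Notation P := {mpoly F[n]}.
Local Notation A := (polyext F n).

(** Independence holds over all polynomials. Applying g to the expansion of an invariant form gives
    an expansion of the same form, so g fixes the coefficients. *)
Lemma adapted_invariants_free :
  free_of_rank (polyext_invariants G : lmodType (mpoly_invariants G)) (2 ^ n)%N.
Proof.
have [w wP] := flag_basis F m_le m_mono.
have w_inv S : w S \in polyext_inv G.
  have [wg _ _ _] := wP S; apply/forall_inP=> g /G_adapted ga.
  by apply/eqP; apply: wg.
have w_below (S : {set 'I_n}) l : S \subset [set i : 'I_n | (i < l)%N] -> ext_below l (w S).
  by have [_ wb _ _] := wP S; apply: wb.
have w0 : w set0 = 1 by have [_ _ w1 _] := wP set0; apply: w1.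
have wE (S : {set 'I_n}) : forall j : 'I_n,
    j \in S -> S \subset [set i : 'I_n | (i < j.+1)%N] ->
    frac_ext (w S) = tofrac (flag_disc F n (m j)) *:
      (flag_zeta F (m j) j * \prod_(i in S :\ j) flag_zeta F (m j) i).
  by have [_ _ _ we] := wP S; apply: we.
have subn (S : {set 'I_n}) : S \subset [set i : 'I_n | (i < n)%N].
  by apply/subsetP=> i; rewrite inE.
have w_free (c : {set 'I_n} -> P) : \sum_S c S *: w S = 0 -> forall S, c S = 0.
  move=> e; apply: (flag_basis_independent m_le w_below w0 wE (leqnn n)) e.
  by move=> S; rewrite subn.
pose e (S : {set 'I_n}) : polyext_invariants G := PolyextInvariant (w_inv S).
have val_comb (c : {set 'I_n} -> mpoly_invariants G) :
    val (\sum_S c S *: e S) = \sum_S val (c S) *: w S.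
  exact: (big_morph (val : polyext_invariants G -> A)).
apply: (free_of_rank_family (e := e)); first exact: card_set_ord.
  move=> x; have fx (j : 'I_n) (c : nat -> F) :
      polyext_act (transvection j (m j) c) (val x) = val x.
    by apply/eqP/(forall_inP (valP x)).
  have [c _ xE] := flag_basis_span m_le w0 wE (leqnn n)
    (ext_below_all (val x)) (fun j c _ => fx j c).
  have c_inv S : c S \in Defs.mpoly_inv G.
    apply/forall_inP=> g gG; rewrite -subr_eq0; apply/eqP.
    apply: (w_free (fun S => mpoly_act g (c S) - c S)).
    have gx : polyext_act g (val x) = val x by apply/eqP/(forall_inP (valP x)).
    have e1 : polyext_act g (\sum_S c S *: w S) = \sum_S mpoly_act g (c S) *: w S.
      rewrite polyext_act_sum; apply: eq_bigr => S' _.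
      have [wg _ _ _] := wP S'.
      by rewrite polyext_actZ (wg g (G_adapted gG)).
    have e2 : \sum_S mpoly_act g (c S) *: w S = \sum_S c S *: w S.
      apply: etrans (esym e1) (etrans (congr1 (polyext_act g) (esym xE)) _).
      exact: etrans gx xE.
    exact: sum_scalerB_eq0 e2.
  exists (fun S => MpolyInvariant (c_inv S)); apply: val_inj.
  by rewrite val_comb.
move=> c /(congr1 val); rewrite val_comb => /w_free c0 S.
by apply: val_inj; apply: c0.
Qed.

End FreeInvariants.

(** * Application to the block unipotent group *)

Lemma reshape_index_mono (I : seq nat) (i j : nat) :
  (i <= j)%N -> (reshape_index I i <= reshape_index I j)%N.
Proof. by rewrite (reshape_leq I) => /orP[/ltnW|/andP[/eqP ->]]. Qed.

Lemma transvection_unitmx (F : finFieldType) (n m : nat) (j : 'I_n) (c : nat -> F) :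
  (m <= j)%N -> transvection j m c \in unitmx.
Proof.
move=> mj; have low (i k : 'I_n) : (k <= i)%N -> transvection j m c i k = (i == k)%:R.
  have [-> ji|kj _] := eqVneq k j; last exact: transvection_other.
  by apply: transvection_row; apply: leq_trans ji.
rewrite -unitmx_tr unitmxE det_trig.
  by rewrite big1 ?unitr1 // => i _; rewrite mxE low ?eqxx.
apply/is_trig_mxP=> i k ik; rewrite mxE low ?(ltnW ik) //.
by case: eqP ik => // ->; rewrite ltnn.
Qed.

Theorem theorem1p1 (p r n : nat) (F : finFieldType) (I : seq nat)
    (p_prime : prime p) (r_gt0 : (0 < r)%N) (card_F : #|F| = (p ^ r)%N)
    (I_pos : all (fun k => (0 < k)%N) I) (I_sum : sumn I = n) :
  free_of_rank (polyext_invariants (block_unipotent F n I)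
                  : lmodType (mpoly_invariants (block_unipotent F n I)))
               (2 ^ n)%N.
Proof.
pose blk := reshape_index I.
have ex_start (j : 'I_n) : exists k, (blk j <= blk k)%N by exists j.
(* The first position of the block of [j]. Block indices increase with position, so [start j <= i]
   is exactly the condition under which [block_unipotent] prescribes the entry (i, j). *)
pose start j := ex_minn (ex_start j).
have startP (j : 'I_n) (i : nat) : (start j <= i)%N = (blk j <= blk i)%N.
  rewrite /start; case: ex_minnP => s bs smin; apply/idP/idP => [si|]; last exact: smin.
  exact/(leq_trans bs)/reshape_index_mono.
apply: (@adapted_invariants_free F n start).
- by move=> j; rewrite startP.
- move=> i j ij; rewrite startP; apply: (@leq_trans (blk j)).
    exact: reshape_index_mono.
  by rewrite -startP.
- move=> g; rewrite inE => /andP[_ /forallP gE] i k; rewrite startP => ki.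
  by apply/eqP; move/forallP/(_ k)/implyP: (gE i); apply.
move=> j c; rewrite inE transvection_unitmx ?startP //=.
apply/forallP=> i; apply/forallP=> k; apply/implyP=> ki; apply/eqP.
have [e|kj] := eqVneq k j; last exact: transvection_other.
by apply: transvection_row; rewrite startP -e.
Qed.
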